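(* For every integer $r\ge 2$, every connected constraint graph $H$ with at least one edge, and every activity vector $\lambda$ on $H$, there exist positive node-weights $w$ on $H$ such that the $r$-branching $w$-random walk on $H$ induces a simple, invariant Gibbs measure for $\lambda$ on $\hom(\mathbb{T}^r,H)$.
   Context: A constraint graph $H$ is a finite graph with node set $\{1,\dots,q\}$, possibly with loops but no multiple edges; $N(i)$ is the set of nodes adjacent to $i$ (containing $i$ iff $i$ is looped). $\hom(G,H)$ is the set of graph homomorphisms from a countable locally finite loopless graph $G$ (the board, whose vertices are sites) to $H$, with the product $\sigma$-algebra. An activity vector is $\lambda=(\lambda_1,\dots,\lambda_q)$ with all $\lambda_i>0$; for finite $G$ the $\lambda$-measure on $\hom(G,H)$ gives $\varphi$ probability proportional to $\prod_{v}\lambda_{\varphi(v)}$. A patch is a finite set $U$ of sites, $\partial U$ the set of sites outside $U$ adjacent to $U$, $U^+=U\cup\partial U$. A probability measure $\mu$ on $\hom(G,H)$ is a Gibbs measure for $\lambda$ if for every patch $U$ and $\mu$-a.e. $\psi$, the $\mu$-conditional probability that $\varphi|_U=\psi|_U$ given $\varphi|_{G\setminus U}=\psi|_{G\setminus U}$ equals the $\lambda$-measure (on $\hom(U^+,H)$) conditional probability that $\varphi|_U=\psi|_U$ given $\varphi|_{\partial U}=\psi|_{\partial U}$. $\mathbb{T}^r$ is the infinite connected cycle-free graph with all degrees $r+1$. A Gibbs measure on $\hom(T,H)$, $T$ a tree, is simple if for every site $u$ and node $i$, the restrictions of $\varphi$ to the components of $T\setminus\{u\}$ are mutually independent given $\varphi(u)=i$;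 a measure is invariant if it is preserved by every automorphism of the board acting by precomposition. The $r$-branching $w$-random walk (for positive weights $w_i$, $z_i=\sum_{j\in N(i)}w_j$): fix a root $x$, choose $\varphi(x)=i$ with probability proportional to $w_iz_i$, and going outward give each non-root site $v$ with parent $u$ spin $j\in N(\varphi(u))$ with probability $w_j/z_{\varphi(u)}$, independently given $\varphi(u)$; its law is the induced measure. *)

(* Defs.v *)
From HB Require Import structures.
From mathcomp Require Import all_boot all_order all_algebra.
From mathcomp Require Import all_classical all_reals all_analysis.
Set Implicit Arguments. Unset Strict Implicit. Unset Printing Implicit Defensive.
Import Order.TTheory GRing.Theory Num.Theory.
Local Open Scope classical_set_scope.
Local Open Scope ring_scope.

(* ---------- The board T^r : reduced words over 'I_r.+1 ---------- *)
Definition reduced (r : nat) (s : seq 'I_r.+1) : bool := sorted (fun a b => a != b) s.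

Record site (r : nat) := Site { word : seq 'I_r.+1 ; _ : reduced word }.
HB.instance Definition _ r := [isSub for @word r].
HB.instance Definition _ r := [Countable of site r by <:].

Definition root (r : nat) : site r := @Site r [::] isT.

Definition droplast (T : Type) (s : seq T) := take (size s).-1 s.

Definition child (r : nat) (u v : site r) : bool :=
  (word v != [::]) && (droplast (word v) == word u).

Definition tadj (r : nat) : rel (site r) := fun u v => child u v || child v u.

Definition parent (r : nat) (v : site r) : site r := insubd (root r) (droplast (word v)).

Fixpoint words (r : nat) (N : nat) : seq (seq 'I_r.+1) :=
  match N with
  | 0 => [:: [::]]
  | k.+1 => [::] :: [seq a :: s | a <- enum 'I_r.+1, s <- words r k]
  end.

Definition ball (r N : nat) : seq (site r) := pmap insub (words r N).

(* node set of H is 'I_q.+1 (q+1 >= 1 nodes); pointedness is needed by measurableType *)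
HB.instance Definition _ (q : nat) := isPointed.Build 'I_q.+1 ord0.

Definition cyl (r q : nat) : set (set (site r -> 'I_q.+1)) :=
  [set A | exists v i, A = [set f | f v = i]].

Definition Omega (r q : nat) := g_sigma_algebraType (@cyl r q).

Definition coord_sigma (r q : nat) (S : set (site r)) : set (set (Omega r q)) :=
  <<s [set A | exists v i, S v /\ A = [set f : Omega r q | f v = i]] >>.

Definition homs (r q : nat) (adj : rel 'I_q.+1) : set (Omega r q) :=
  [set f | forall u v, tadj u v -> adj (f u) (f v)].

Definition inplus (r : nat) (U : seq (site r)) (v : site r) : bool :=
  (v \in U) || has (fun u => tadj u v) U.

Definition mix (r q : nat) (U : seq (site r)) (xi phi : site r -> 'I_q.+1) :=
  fun v => if v \in U then xi v else phi v.

Definition weightU (R : realType) (r q : nat) (adj : rel 'I_q.+1)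
  (lam : 'I_q.+1 -> R) (U : seq (site r)) (psi : site r -> 'I_q.+1) : R :=
  (\prod_(u <- U) lam (psi u)) *
  (`[< forall u v, inplus U u -> inplus U v -> tadj u v -> adj (psi u) (psi v) >])%:R.

Definition gamma (R : realType) (r q : nat) (adj : rel 'I_q.+1)
  (lam : 'I_q.+1 -> R) (U : seq (site r)) (xi phi : site r -> 'I_q.+1) : R :=
  weightU adj lam U (mix U xi phi) /
  \sum_(zeta : (size U).-tuple 'I_q.+1)
     weightU adj lam U (mix U (fun v => nth ord0 zeta (index v U)) phi).

Definition is_gibbs (R : realType) (r q : nat) (adj : rel 'I_q.+1)
  (lam : 'I_q.+1 -> R) (mu : probability (Omega r q) R) : Prop :=
  mu (@homs r q adj) = 1%E /\
  forall (U : seq (site r)), uniq U ->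
  forall (xi : site r -> 'I_q.+1) (A : set (Omega r q)),
    @coord_sigma r q (~` [set u | u \in U]) A ->
    mu ([set phi : Omega r q | {in U, phi =1 xi}] `&` A) =
      (\int[mu]_(phi in A) (gamma adj lam U xi phi)%:E)%E.

Definition condP (R : realType) (r q : nat) (mu : probability (Omega r q) R)
  (X E : set (Omega r q)) : R := fine (mu (X `&` E)) / fine (mu E).

Definition comp (r : nat) (u v : site r) : set (site r) :=
  [set w | exists p : seq (site r), [/\ path (@tadj r) v p, last v p = w & u \notin v :: p]].

Definition is_simple (R : realType) (r q : nat) (mu : probability (Omega r q) R) : Prop :=
  forall (u : site r) (i : 'I_q.+1),
    let E := [set phi : Omega r q | phi u = i] in
    (0 < mu E)%E ->
    forall (vs : seq (site r)) (A : site r -> set (Omega r q)),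
      uniq vs -> all (tadj u) vs ->
      (forall v, v \in vs -> @coord_sigma r q (comp u v) (A v)) ->
      condP mu (\bigcap_(v in [set v | v \in vs]) A v) E = \prod_(v <- vs) condP mu (A v) E.

Definition automorphism (r : nat) (s : site r -> site r) : Prop :=
  bijective s /\ forall u v, tadj (s u) (s v) = tadj u v.

Definition is_invariant (R : realType) (r q : nat) (mu : probability (Omega r q) R) : Prop :=
  forall s : site r -> site r, automorphism s ->
  forall A : set (Omega r q), measurable A ->
    mu ((fun phi : Omega r q => (phi \o s : Omega r q)) @^-1` A) = mu A.

Definition zw (R : realType) (q : nat) (adj : rel 'I_q.+1) (w : 'I_q.+1 -> R) (i : 'I_q.+1) : R :=
  \sum_(j | adj i j) w j.

Definition rw_cyl (R : realType) (r q : nat) (adj : rel 'I_q.+1) (w : 'I_q.+1 -> R)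
  (xi : site r -> 'I_q.+1) (N : nat) : R :=
  (w (xi (root r)) * zw adj w (xi (root r)) / \sum_i (w i * zw adj w i)) *
  \prod_(v <- ball r N | v != root r)
     ((adj (xi (parent v)) (xi v))%:R * (w (xi v) / zw adj w (xi (parent v)))).

Definition is_rw_law (R : realType) (r q : nat) (adj : rel 'I_q.+1) (w : 'I_q.+1 -> R)
  (mu : probability (Omega r q) R) : Prop :=
  forall (N : nat) (xi : site r -> 'I_q.+1),
    mu [set phi : Omega r q | forall v, v \in ball r N -> phi v = xi v] = (rw_cyl adj w xi N)%:E.

(* Main.v *)
Require Import Defs.
From HB Require Import structures.
From mathcomp Require Import all_boot all_order all_algebra.
From mathcomp Require Import all_classical all_reals all_analysis.
From mathcomp Require Import measurable_realfun.
From mathcomp Require Import ring lra zify.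
Import numFieldNormedType.Exports Defs.
Set Implicit Arguments. Unset Strict Implicit. Unset Printing Implicit Defensive.
Import Order.TTheory GRing.Theory Num.Theory.
Local Open Scope classical_set_scope.
Local Open Scope ring_scope.

(** Write z_i for the total weight of the neighbours of i.  Weights with
    lam_i = kappa w_i / z_i^r exist because w_i = lam_i t_i^r has this property
    when t >= 0 maximises
      sum_(i ~ j) lam_i lam_j t_i^r t_j^r - (sum_i lam_i t_i^(r+1))^2:
    where t_i > 0 the i-th partial derivative vanishes, which makes t_i
    proportional to z_i, and t_i = 0 is impossible next to a positive t_j because
    the first sum would grow at order t_i^r and the square only at order t_i^(r+1).

    The random walk is realised on [0, 1[ by successively subdividing intervals
    along a breadth-first enumeration of the sites.  In the law of a ball every
    interior site contributes w_i / z_i^r, hence lam_i up to a constant; this is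
    the Gibbs property.  The law also factorises across an edge, so the spins on
    the two sides of an edge u v are independent given the spin at u; this yields
    simplicity, and, together with the symmetric edge marginals
    w_i w_j / sum_k w_k z_k, it determines the law of every connected finite set
    from any starting site, hence invariance. *)

(** * Existence of the weights *)

Section Weights.
Variables (R : realType) (q : nat) (adj : rel 'I_q.+1) (adj_sym : symmetric adj).
Variables (lam : 'I_q.+1 -> R) (lam_pos : forall i, 0 < lam i).

Definition nweight (r : nat) (t : 'I_q.+1 -> R) i := lam i * t i ^+ r.
Definition quad (w : 'I_q.+1 -> R) := \sum_i w i * zw adj w i.
Definition mass (r : nat) (t : 'I_q.+1 -> R) := \sum_i lam i * t i ^+ r.+1.
(** The first term has degree 2r in [t] and the second degree 2r + 2, so small [t] can make the
    energy positive, while a large coordinate forces it to be nonpositive. *)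
Definition energy r t := quad (nweight r t) - mass r t ^+ 2.
Definition update_at (t : 'I_q.+1 -> R) i x := fun j => if j == i then x else t j.

Lemma zwE (w : 'I_q.+1 -> R) i : zw adj w i = \sum_j (adj i j)%:R * w j.
Proof.
rewrite /zw big_mkcond; apply: eq_bigr => j _.
by case: (adj i j); rewrite ?mul1r ?mul0r.
Qed.

Lemma sum_delta (F : 'I_q.+1 -> R) i : \sum_j F j * (j == i)%:R = F i.
Proof.
rewrite (bigD1 i) //= eqxx mulr1 big1 ?addr0 // => j /negPf ->.
by rewrite mulr0.
Qed.

(** A quadratic form expanded exactly along one coordinate; the symmetry of [adj] merges the two
    cross terms. *)
Lemma quad_add (w w' : 'I_q.+1 -> R) i d :
  (forall j, w' j = w j + d * (j == i)%:R) ->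
  quad w' = quad w + 2 * d * zw adj w i + (adj i i)%:R * d ^+ 2.
Proof.
move=> w'E.
have zE k : zw adj w' k = zw adj w k + d * (adj k i)%:R.
  rewrite !zwE -(sum_delta (fun j => (adj k j)%:R) i) mulr_sumr -big_split /=.
  by apply: eq_bigr => j _; rewrite w'E; ring.
rewrite /quad.
under eq_bigr => k _ do rewrite zE w'E.
have -> : \sum_k (w k + d * (k == i)%:R) * (zw adj w k + d * (adj k i)%:R) =
  \sum_k (w k * zw adj w k + d * ((adj i k)%:R * w k) +
     (d * (zw adj w k + d * (adj k i)%:R)) * (k == i)%:R).
  by apply: eq_bigr => k _; rewrite (adj_sym i k); ring.
rewrite !big_split /= sum_delta -mulr_sumr -zwE; ring.
Qed.

Lemma nweight_update r t i x j :
  nweight r (update_at t i x) j =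
  nweight r t j + lam i * (x ^+ r - t i ^+ r) * (j == i)%:R.
Proof.
rewrite /nweight /update_at; case: eqP => [->|_] /=; last by rewrite mulr0 addr0.
by ring.
Qed.

Lemma mass_update r t i x :
  mass r (update_at t i x) = mass r t + lam i * (x ^+ r.+1 - t i ^+ r.+1).
Proof.
rewrite -(sum_delta (fun i => lam i * (x ^+ r.+1 - t i ^+ r.+1)) i) /mass.
rewrite -big_split /=; apply: eq_bigr => j _.
by rewrite /update_at; case: eqP => [->|_] /=; ring.
Qed.

(** Being exact, this increment serves both for differentiating at a positive coordinate and for
    comparing orders at a vanishing one. *)
Lemma energy_update r t i x (d := lam i * (x ^+ r - t i ^+ r))
  (e := lam i * (x ^+ r.+1 - t i ^+ r.+1)) :
  energy r (update_at t i x) - energy r t =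
  2 * d * zw adj (nweight r t) i + (adj i i)%:R * d ^+ 2
  - 2 * mass r t * e - e ^+ 2.
Proof.
rewrite /energy (quad_add (nweight_update r t i x)) mass_update -/d -/e.
by ring.
Qed.

(** * Existence of a maximiser and positivity of the maximum *)

Lemma continuous_sum (T : topologicalType) (F : 'I_q.+1 -> T -> R) :
  (forall i, continuous (F i)) -> continuous (fun v => \sum_i F i v).
Proof.
move=> cF; apply: (@continuous_big _ _ (@GRing.add R)) => [|i _]; last exact: cF.
exact: add_continuous.
Qed.

Lemma continuous_exp (T : topologicalType) (f : T -> R) n :
  continuous f -> continuous (fun v => f v ^+ n).
Proof. by move=> cf v; exact: (cvg_comp _ _ (cf v) (@exprn_continuous R n (f v))). Qed.

Lemma continuous_scale (T : topologicalType) (f : T -> R) a :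
  continuous f -> continuous (fun v => a * f v).
Proof. by move=> cf v; exact: (cvg_comp _ _ (cf v) (@mulrl_continuous _ a (f v))). Qed.

Lemma continuous_energy r :
  continuous (fun v : 'rV[R]_q.+1 => energy r (fun i => v ord0 i)).
Proof.
have cX n i : continuous (fun v : 'rV[R]_q.+1 => lam i * v ord0 i ^+ n).
  apply: (@continuous_scale _ (fun v : 'rV[R]_q.+1 => v ord0 i ^+ n)).
  by apply: (@continuous_exp _ (fun v : 'rV[R]_q.+1 => v ord0 i)); exact: coord_continuous.
move=> v; apply: (@continuousB _ _ _ (fun v : 'rV[R]_q.+1 => quad (nweight r (fun i => v ord0 i)))
  (fun v : 'rV[R]_q.+1 => mass r (fun i => v ord0 i) ^+ 2)); last first.
  move: v; apply: (@continuous_exp _ (fun v : 'rV[R]_q.+1 => mass r (fun i => v ord0 i))).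
  by apply: (@continuous_sum _ (fun i (v : 'rV[R]_q.+1) => lam i * v ord0 i ^+ r.+1)) => i; exact: cX.
pose W i (v : 'rV[R]_q.+1) := nweight r (fun i => v ord0 i) i.
have cW i : continuous (W i) by exact: (cX r i).
move: v; apply: (@continuous_sum _ (fun i v => W i v * zw adj (W^~ v) i)) => i v.
apply: (@continuousM _ _ (W i) (fun v => zw adj (W^~ v) i)); first exact: cW.
rewrite (_ : (fun v => zw adj (W^~ v) i) =
    fun v => \sum_j (adj i j)%:R * W j v); last by apply/funext => u; rewrite zwE.
move: v; apply: (@continuous_sum _ (fun j v => (adj i j)%:R * W j v)) => j.
exact: (@continuous_scale _ (W j) _ (cW j)).
Qed.

(** The form is at most the square of the total weight. If [m] maximises [t], the total weight is at
    most lam_m M t_m^r, hence at most lam_m t_m^(r+1), a single term of the mass. *)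
Lemma energy_le0 r t (M : R) i0 :
  (forall i, 0 <= t i) -> (forall i, \sum_j lam j <= lam i * M) ->
  M <= t i0 -> energy r t <= 0.
Proof.
move=> t0 hM Mt.
have [m _ tm] := @Order.TotalTheory.arg_maxP _ _ _ i0 predT t isT.
have w0 i : 0 <= nweight r t i by rewrite mulr_ge0 ?exprn_ge0 // ltW.
have sum0 : 0 <= \sum_j nweight r t j by apply: sumr_ge0.
have q1 : quad (nweight r t) <= (\sum_j nweight r t j) ^+ 2.
  rewrite expr2 [leRHS]mulr_suml; apply: ler_sum => i _.
  by apply: ler_wpM2l => //; rewrite /zw big_mkcond; apply: ler_sum => j _; case: ifP.
rewrite subr_le0 (le_trans q1) // lerXn2r ?nnegrE //.
  by apply: sumr_ge0 => i _; rewrite mulr_ge0 ?exprn_ge0 // ltW.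
apply: (@le_trans _ _ (lam m * t m ^+ r.+1)); last first.
  rewrite /mass (bigD1 m) //= lerDl; apply: sumr_ge0 => i _.
  by rewrite mulr_ge0 ?exprn_ge0 // ltW.
apply: (@le_trans _ _ ((\sum_j lam j) * t m ^+ r)).
  rewrite mulr_suml; apply: ler_sum => i _.
  by rewrite /nweight ler_pM2l ?lam_pos // lerXn2r ?nnegrE //; exact: tm.
rewrite exprS mulrA ler_wpM2r ?exprn_ge0 // (le_trans (hM m)) //.
by rewrite ler_pM2l ?lam_pos // (le_trans Mt) //; exact: tm.
Qed.

Lemma energy_max r : (0 < r)%N -> exists t : 'I_q.+1 -> R, (forall i, 0 <= t i) /\
  forall t', (forall i, 0 <= t' i) -> energy r t' <= energy r t.
Proof.
move=> r0.
pose L := \sum_j lam j.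
have L0 : 0 <= L by apply: sumr_ge0 => i _; rewrite ltW.
(* [M] dominates every [L / lam i], as [energy_le0] demands; a nonnegative vector outside the box
   [0, M]^(q+1) then has energy at most 0, the energy of the origin, which lies in the box. *)
pose M := \sum_i (L / lam i).
have M0 : 0 <= M by apply: sumr_ge0 => i _; rewrite divr_ge0 // ltW.
have hM i : L <= lam i * M.
  rewrite /M (bigD1 i) //= mulrDr mulrCA divff ?gt_eqF // mulr1 lerDl.
  by rewrite mulr_ge0 ?sumr_ge0 // => [|j _]; rewrite ?divr_ge0 // ltW.
pose A := [set v : 'rV[R]_q.+1 | forall i, v ord0 i \in `[0, M]%R].
have cA : compact A.
  apply: (@rV_compact _ _ (fun=> `[0, M]%classic)) => i.
  exact: segment_compact.
have A0 : A !=set0.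
  by exists (\row_i 0) => i; rewrite mxE in_itv /= lexx M0.
have cE : {within A, continuous (fun v : 'rV[R]_q.+1 => energy r (fun i => v ord0 i))}.
  exact/continuous_subspaceT/continuous_energy.
have [v /set_mem Av vmax] := EVT_max_rV A0 cA cE.
have key t' : (forall i, t' i \in `[0, M]%R) -> energy r t' <= energy r (fun i => v ord0 i).
  move=> t'A; have -> : t' = fun i => (\row_i t' i) ord0 i.
    by apply/funext => i; rewrite mxE.
  by apply: vmax; rewrite inE => i; rewrite mxE.
exists (fun i => v ord0 i); split => [i|t' t'0].
  by have := Av i; rewrite in_itv /= => /andP[].
case: (boolP [forall i, t' i <= M]) => [/forallP h|].
  by apply: key => i; rewrite in_itv /= t'0 h.
rewrite negb_forall => /existsP[i]; rewrite -ltNge => /ltW iM.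
apply: (le_trans (energy_le0 r t'0 hM iM)).
have -> : 0 = energy r (fun=> 0).
  have Q0 : quad (nweight r (fun=> 0)) = 0.
    by apply: big1 => j _; rewrite /nweight expr0n eqn0Ngt r0 mulr0 mul0r.
  have S0 : mass r (fun=> 0) = 0 by apply: big1 => j _; rewrite expr0n mulr0.
  by rewrite /energy Q0 S0 expr0n subr0.
by apply: key => j; rewrite in_itv /= lexx M0.
Qed.

Lemma zw_ge0 (w : 'I_q.+1 -> R) i : (forall j, 0 <= w j) -> 0 <= zw adj w i.
Proof. by move=> w0; rewrite sumr_ge0. Qed.

Lemma exists_edge_energy r : (0 < r)%N -> (exists i j, adj i j) ->
  exists t : 'I_q.+1 -> R, (forall i, 0 <= t i) /\ 0 < energy r t.
Proof.
move=> r0 [i [j ij]].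
pose L := \sum_j lam j.
have L0 : 0 <= L by apply: sumr_ge0 => k _; rewrite ltW.
have z0 k : 0 <= zw adj lam k by apply: zw_ge0 => l; rewrite ltW.
have Q0 : 0 < quad lam.
  rewrite /quad (bigD1 i) //= ltr_pwDl //.
    by rewrite mulr_gt0 // /zw (bigD1 j) //= ltr_pwDl // sumr_ge0 // => k _; rewrite ltW.
  by rewrite sumr_ge0 // => k _; rewrite mulr_ge0 // ltW.
(* On constant vectors the energy is e^(2r) (quad lam - e^2 L^2); this [e] satisfies e < 1 and e L^2
   < quad lam, so the bracket is positive. *)
pose e := quad lam / (quad lam + L ^+ 2 + 1).
have D0 : 0 < quad lam + L ^+ 2 + 1 by rewrite ltr_wpDl // addr_ge0 ?exprn_ge0 // ltW.
have e0 : 0 < e by rewrite divr_gt0.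
have e1 : e < 1.
  by rewrite ltr_pdivrMr // mul1r -addrA ltrDl ltr_wpDl // exprn_ge0.
have eL : e * L ^+ 2 < quad lam.
  rewrite /e mulrAC ltr_pdivrMr // ltr_pM2l //.
  by rewrite -addrA addrCA ltrDl ltr_pwDl.
exists (fun=> e); split => [k|]; first exact: ltW.
have -> : energy r (fun=> e) = e ^+ r ^+ 2 * (quad lam - e ^+ 2 * L ^+ 2).
  rewrite /energy /mass -mulr_suml -/L.
  have -> : quad (nweight r (fun=> e)) = e ^+ r ^+ 2 * quad lam.
    rewrite /quad mulr_sumr; apply: eq_bigr => k _; rewrite /zw /nweight -mulr_suml.
    by move: (e ^+ r) => E; ring.
  by rewrite (exprS e r); move: (e ^+ r) => E; ring.
rewrite mulr_gt0 ?exprn_gt0 // subr_gt0 (le_lt_trans _ eL) //.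
rewrite ler_wpM2r ?exprn_ge0 // expr2 ger_pMl //; exact: ltW.
Qed.

(** Terms quadratic in the increments [d] and [e] have zero derivative where both vanish, so only
    the linear ones reach the critical-point equation. *)
Lemma deriv_at_root (d e : {poly R}) (x a b c : R) : d.[x] = 0 -> e.[x] = 0 ->
  (polyC a * d + polyC b * (d * d) - polyC c * e - e * e)^`().[x] =
  a * d^`().[x] - c * e^`().[x].
Proof.
move=> d0 e0; rewrite !derivB derivD !derivM !derivC.
by rewrite !(hornerD, hornerN, hornerM, hornerC) d0 e0; ring.
Qed.

(* Where t_i > 0 the partial derivative of the energy vanishes. *)
Lemma max_critical r (t : 'I_q.+1 -> R) i : (0 < r)%N -> (forall i, 0 <= t i) -> 0 < t i ->
  (forall t', (forall i, 0 <= t' i) -> energy r t' <= energy r t) ->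
  r%:R * zw adj (nweight r t) i = r.+1%:R * mass r t * t i.
Proof.
move=> r0 t0 ti tmax.
set z := zw adj _ i; set S := mass r t.
(* The change of energy when t_i is replaced by x is a polynomial [p] in x, whose maximum over x > 0
   is reached at [t i]. *)
pose d : {poly R} := polyC (lam i) * ('X^r - polyC (t i ^+ r))%R.
pose e : {poly R} := polyC (lam i) * ('X^(r.+1) - polyC (t i ^+ r.+1))%R.
pose p : {poly R} := polyC (2 * z) * d + polyC (adj i i)%:R * (d * d) - polyC (2 * S) * e - e * e.
have pE x : p.[x] = energy r (update_at t i x) - energy r t.
  by rewrite energy_update -/z -/S /p /d /e !hornerE /=; ring.
have pt : p.[t i] = 0.
  by rewrite pE (_ : update_at t i (t i) = t) ?subrr //; apply/funext => j; rewrite /update_at; case: eqP => [->|].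
have := @derive1_at_max _ (horner p) 0 (t i + 1) (t i).
case.
- by rewrite addr_ge0.
- by move=> x _; exact: derivable_horner.
- by rewrite in_itv /= ti ltrDl ltr01.
- move=> x; rewrite in_itv /= => /andP[x0 _]; rewrite pt pE subr_le0.
  by apply: tmax => j; rewrite /update_at; case: eqP => // _; exact: ltW.
move=> _; rewrite -derive1E -derivE.
have dt : d.[t i] = 0 by rewrite /d !hornerE subrr mulr0.
have et : e.[t i] = 0 by rewrite /e !hornerE subrr mulr0.
have d't : d^`().[t i] = lam i * (t i ^+ r.-1 *+ r).
  by rewrite /d derivM derivB derivXn !derivC mul0r add0r subr0 !hornerE hornerMn hornerXn.
have e't : e^`().[t i] = lam i * (t i ^+ r *+ r.+1).
  by rewrite /e derivM derivB derivXn !derivC mul0r add0r subr0 !hornerE hornerMn hornerXn.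
have -> : p^`().[t i] = 2 * z * d^`().[t i] - 2 * S * e^`().[t i].
  exact: deriv_at_root.
rewrite d't e't; case: (r) r0 => // n _ /=.
rewrite -[t i ^+ n *+ _]mulr_natl -[t i ^+ n.+1 *+ _]mulr_natl => /eqP.
rewrite subr_eq0 => /eqP h.
(* With r = n + 1, this is the common factor of both sides that is cancelled. *)
have nz : 2 * (lam i * t i ^+ n) != 0 by rewrite !mulf_neq0 ?expf_neq0 ?gt_eqF.
apply: (mulfI nz); move: h; rewrite exprS; move: (t i ^+ n) => T h.
transitivity (2 * z * (lam i * (n.+1%:R * T))); first by ring.
by rewrite h; ring.
Qed.

Lemma max_boundary r (t : 'I_q.+1 -> R) i : (0 < r)%N -> (forall i, 0 <= t i) -> t i = 0 ->
  (forall t', (forall i, 0 <= t' i) -> energy r t' <= energy r t) ->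
  zw adj (nweight r t) i = 0.
Proof.
move=> r0 t0 ti tmax.
set z := zw adj _ i; pose S := mass r t.
have z0 : 0 <= z by apply: zw_ge0 => j; rewrite mulr_ge0 ?exprn_ge0 // ltW.
have S0 : 0 <= S by apply: sumr_ge0 => j _; rewrite mulr_ge0 ?exprn_ge0 // ltW.
have l0 := lam_pos i.
apply/eqP; rewrite eq_le z0 andbT leNgt; apply/negP => zp.
(* The denominator gives x <= 1 and x (S + lam_i) < z, so the gain 2 lam_i x^r z outweighs the
   losses 2 S lam_i x^(r+1) and (lam_i x^(r+1))^2. *)
pose x := z / (S + lam i + z + 1).
have D0 : 0 < S + lam i + z + 1 by lra.
have x0 : 0 < x by rewrite divr_gt0.
have x1 : x <= 1 by rewrite ler_pdivrMr // mul1r; lra.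
have xz : x * (S + lam i) < z.
  by rewrite /x mulrAC ltr_pdivrMr // ltr_pM2l //; lra.
clearbody x.
have := energy_update r t i x; rewrite -/z -/S ti !expr0n /= eqn0Ngt r0 /= !subr0 => h.
have : energy r (update_at t i x) - energy r t <= 0.
  by rewrite subr_le0; apply: tmax => j; rewrite /update_at; case: eqP => // _; exact: ltW.
apply/negP; rewrite h -ltNge (exprS x r).
have xr : 0 < x ^+ r by rewrite exprn_gt0.
have xr1 : x ^+ r <= 1 by rewrite exprn_ile1 // ltW.
have a0 : 0 <= (adj i i)%:R :> R by [].
move: (x ^+ r) xr xr1 (_ %:R) a0 => X X0 X1 a a0.
have lX : 0 < lam i * X by rewrite mulr_gt0.
have e1 : 0 <= a * (lam i * X) ^+ 2 by rewrite mulr_ge0 // exprn_ge0 // ltW.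
have e2 : lam i * (x * X) <= x * lam i.
  by rewrite mulrCA mulrA ger_pMr // mulr_gt0.
have e3 : x * lam i * x * X <= x * lam i.
  rewrite -mulrA ger_pMr; last exact: mulr_gt0.
  by apply: mulr_ile1 => //; exact: ltW.
have : 0 < a * (lam i * X) ^+ 2 + (lam i * X) * (2 * z - 2 * S * x - x * lam i * x * X).
  rewrite ltr_wpDl // mulr_gt0 //.
  have : 0 < x * lam i by rewrite mulr_gt0.
  by move: xz; rewrite mulrDr (mulrC x S); lra.
by congr (_ < _); ring.
Qed.

Lemma walk_weights r : (0 < r)%N -> (forall i j : 'I_q.+1, connect adj i j) ->
  (exists i j, adj i j) ->
  exists (w : 'I_q.+1 -> R) (kappa : R), [/\ forall i, 0 < w i, forall i, 0 < zw adj w i, 0 < kappa &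
    forall i, lam i * zw adj w i ^+ r = kappa * w i].
Proof.
move=> r0 conn edge.
have [t [t0 tmax]] := energy_max r0.
have [t' [t'0 Et']] := exists_edge_energy r0 edge.
have Et : 0 < energy r t by apply: lt_le_trans Et' (tmax _ t'0).
have nw0 i : 0 <= nweight r t i by rewrite mulr_ge0 ?exprn_ge0 // ltW.
have [i ti] : exists i, 0 < t i.
  apply/not_existsP => H.
  have tz i : t i = 0 by apply/eqP; rewrite eq_le t0 andbT leNgt; apply/negP/H.
  move: Et; rewrite /energy /quad big1 ?sub0r ?oppr_gt0 => [|i _].
    by rewrite ltNge sqr_ge0.
  by rewrite /nweight tz expr0n eqn0Ngt r0 mulr0 mul0r.
(* Positivity spreads along edges: a vanishing coordinate next to a positive one would have a
   positive [zw], against [max_boundary]. *)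
have tpos j : 0 < t j.
  have /connectP[p] := conn i j.
  elim: p i ti => [|k p IH] i ti /=; first by move=> _ ->.
  case/andP => ik kp jE; apply: (IH k) => //.
  rewrite lt_neqAle t0 andbT eq_sym; apply/eqP => tk.
  have := max_boundary r0 t0 tk tmax; apply/eqP; rewrite gt_eqF //.
  rewrite /zw (bigD1 i) /=; last by rewrite adj_sym.
  by rewrite ltr_pwDl ?sumr_ge0 // mulr_gt0 ?exprn_gt0.
have S0 : 0 < mass r t.
  rewrite /mass (bigD1 i) //= ltr_pwDl ?sumr_ge0 // => [|j _].
    by rewrite mulr_gt0 ?exprn_gt0.
  by rewrite mulr_ge0 ?exprn_ge0 // ltW.
(* Criticality reads z_j = c t_j with c = (r+1)/r times the mass, so lam_j z_j^r = c^r lam_j t_j^r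
   and [kappa] is c^r. *)
have zt j : zw adj (nweight r t) j = r.+1%:R / r%:R * mass r t * t j.
  have := max_critical r0 t0 (tpos j) tmax.
  have rn0 : r%:R != 0 :> R by rewrite pnatr_eq0 -lt0n.
  by move=> h; apply: (mulfI rn0); rewrite h; field.
have c0 : 0 < r.+1%:R / r%:R * mass r t by rewrite mulr_gt0 // divr_gt0 // ltr0n.
exists (nweight r t), ((r.+1%:R / r%:R * mass r t) ^+ r); split.
- by move=> j; rewrite mulr_gt0 ?exprn_gt0.
- by move=> j; rewrite zt mulr_gt0.
- by rewrite exprn_gt0.
- by move=> j; rewrite zt exprMn /nweight mulrCA.
Qed.

End Weights.

(** * The tree *)

Section Tree.
Variable r : nat.
Implicit Types (u v : site r) (s : seq 'I_r.+1).

Lemma mem_words N s : (s \in words r N) = (size s <= N)%N.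
Proof.
elim: N s => [|N IH] [|a s] //=; rewrite inE /= ltnS -IH.
apply/allpairsP/idP => [[[b t] [_ ht [_ ->]]] //|hs].
by exists (a, s); rewrite mem_enum.
Qed.

Lemma uniq_words N : uniq (words r N).
Proof.
elim: N => [|N IH] //=; rewrite allpairs_uniq ?enum_uniq // ?andbT; last first.
  by move=> [a s] [b t] _ _ [-> ->].
by apply/allpairsP => -[[a s] []].
Qed.

Lemma mem_ball N v : (v \in ball r N) = (size (word v) <= N)%N.
Proof. by rewrite mem_pmap_sub mem_words. Qed.

Lemma uniq_ball N : uniq (ball r N).
Proof. by rewrite pmap_sub_uniq // uniq_words. Qed.

Lemma word_parent v : word (parent v) = droplast (word v).
Proof. by rewrite /parent val_insubd; have := take_sorted (size (word v)).-1 (valP v); rewrite /reduced => ->. Qed.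

Lemma word_nil v : (word v == [::]) = (v == root r).
Proof. by rewrite -val_eqE. Qed.

Lemma size_parent v : size (word (parent v)) = (size (word v)).-1.
Proof. by rewrite word_parent size_takel // leq_pred. Qed.

Lemma parent_root : parent (root r) = root r.
Proof. by apply/val_inj; rewrite /= word_parent. Qed.

Lemma childE u v : child u v = (v != root r) && (u == parent v).
Proof. by rewrite /child word_nil -word_parent (eq_sym u) -val_eqE. Qed.

Lemma child_parent v : v != root r -> child (parent v) v.
Proof. by rewrite childE eqxx andbT. Qed.

Lemma tadj_sym u v : tadj u v = tadj v u.
Proof. by rewrite /tadj orbC. Qed.

Lemma size_gt0 v : (0 < size (word v))%N = (v != root r).
Proof. by rewrite lt0n size_eq0 word_nil. Qed.

Definition level N : seq (site r) := [seq v <- ball r N | size (word v) == N].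

Fixpoint bfs N : seq (site r) := if N is n.+1 then bfs n ++ level n.+1 else level 0.

Lemma mem_level N v : (v \in level N) = (size (word v) == N).
Proof. by rewrite mem_filter mem_ball; case: eqP => // ->; rewrite leqnn. Qed.

Lemma mem_bfs N v : (v \in bfs N) = (size (word v) <= N)%N.
Proof.
elim: N => [|N IH] /=; first by rewrite mem_level leqn0.
by rewrite mem_cat IH mem_level [in RHS]leq_eqVlt orbC ltnS.
Qed.

Lemma uniq_bfs N : uniq (bfs N).
Proof.
elim: N => [|N IH] /=; first by rewrite filter_uniq // uniq_ball.
rewrite cat_uniq IH filter_uniq ?uniq_ball // andbT /=.
by apply/hasPn => v; rewrite mem_level mem_bfs => /eqP ->; rewrite ltnn.
Qed.

Lemma perm_bfs N : perm_eq (ball r N) (bfs N).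
Proof. by apply: uniq_perm; rewrite ?uniq_ball ?uniq_bfs // => v; rewrite mem_ball mem_bfs. Qed.

Lemma level0 : level 0 = [:: root r].
Proof.
apply: perm_small_eq => //; apply: uniq_perm => // [|v].
  by rewrite filter_uniq // uniq_ball.
by rewrite mem_level size_eq0 word_nil inE.
Qed.

Lemma bfs_prefix N M : (N <= M)%N -> exists t, bfs M = bfs N ++ t.
Proof.
elim: M => [|M IH]; first by rewrite leqn0 => /eqP ->; exists [::]; rewrite cats0.
rewrite leq_eqVlt => /orP[/eqP ->|]; first by exists [::]; rewrite cats0.
rewrite ltnS => /IH[t E]; exists (t ++ level M.+1).
by rewrite /= E catA.
Qed.

(** The lists [bfs N] extend one another, so the position of [v] is the same in every one that
    contains it; the first of them is used. *)
Definition idx v := index v (bfs (size (word v))).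

Lemma idx_bfs N v : v \in bfs N -> index v (bfs N) = idx v.
Proof.
rewrite mem_bfs => /bfs_prefix[t ->].
by rewrite index_cat mem_bfs leqnn.
Qed.

Lemma idx_inj : injective idx.
Proof.
move=> u v; set N := maxn (size (word u)) (size (word v)).
have uN : u \in bfs N by rewrite mem_bfs leq_maxl.
have vN : v \in bfs N by rewrite mem_bfs leq_maxr.
rewrite -(idx_bfs uN) -(idx_bfs vN) => h.
by rewrite -(nth_index u uN) h nth_index.
Qed.

Lemma idx_root : idx (root r) = 0%N.
Proof. by rewrite /idx /= level0 /= ?eqxx. Qed.

(** A parent lies one level up, hence in an earlier block of the enumeration; spins can therefore be
    drawn in this order, each after that of the parent. *)
Lemma idx_parent v : v != root r -> (idx (parent v) < idx v)%N.
Proof.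
move=> vr; rewrite -size_gt0 in vr.
have pv : parent v \in bfs (size (word v)).-1 by rewrite mem_bfs size_parent.
rewrite -(idx_bfs pv) /idx; case hn: (size (word v)) vr pv => [|n] //= _ pv.
rewrite index_cat mem_bfs hn ltnn.
by apply: leq_trans (leq_addr _ _); rewrite index_mem.
Qed.

Definition site_at n : site r := xget (root r) [set v | idx v = n].

Lemma site_at_idx v : site_at (idx v) = v.
Proof. by rewrite /site_at; case: xgetP => [u _ /idx_inj //|] /(_ v)[]. Qed.

Lemma nth_bfs N k : (k < size (bfs N))%N -> idx (nth (root r) (bfs N) k) = k.
Proof. by move=> kN; rewrite -(@idx_bfs N) ?mem_nth // index_uniq // uniq_bfs. Qed.

End Tree.

(** * Sequences with prescribed prefix probabilities *)

Section Intervals.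
Variables (R : realType) (q : nat) (P : seq 'I_q.+1 -> R).
Hypotheses (P_ge0 : forall s, 0 <= P s) (P_nil : P [::] = 1).
Hypothesis P_cons : forall s, P s = \sum_a P (a :: s).

Definition partial_sum (f : 'I_q.+1 -> R) (k : nat) := \sum_(b : 'I_q.+1 | (b < k)%N) f b.

Lemma partial_sumS f (a : 'I_q.+1) : partial_sum f a.+1 = partial_sum f a + f a.
Proof.
rewrite /partial_sum (bigD1 a) //= addrC; congr (_ + _); apply: eq_bigl => b.
by rewrite ltnS ltn_neqAle andbC.
Qed.

Lemma partial_sum_le f k l : (forall a, 0 <= f a) -> (k <= l)%N -> partial_sum f k <= partial_sum f l.
Proof.
move=> f0 kl; rewrite /partial_sum [leRHS](bigID (fun b : 'I_q.+1 => (b < k)%N)) /=.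
rewrite [X in _ <= X + _](_ : _ = partial_sum f k).
  by rewrite lerDl sumr_ge0.
by apply: eq_bigl => b; case: (ltnP b k) => h; rewrite ?andbF // andbT (leq_trans h).
Qed.

Lemma partial_sum0 f : partial_sum f 0 = 0. Proof. by rewrite /partial_sum big_pred0. Qed.

Lemma partial_sumT f : partial_sum f q.+1 = \sum_a f a.
Proof. by apply: eq_bigl => a; rewrite ltn_ord. Qed.

(* The lists are reversed: [a :: s] is the outcome [s] followed by [a]. *)
Fixpoint cell_left (s : seq 'I_q.+1) : R :=
  if s is a :: s' then cell_left s' + partial_sum (fun b => P (b :: s')) a else 0.

Definition cell s : set R := [set x | cell_left s <= x < cell_left s + P s].

Lemma cell_sub a s : cell (a :: s) `<=` cell s.
Proof.
move=> x /andP[/= h1 h2]; apply/andP; split.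
  apply: le_trans h1; rewrite lerDl -(partial_sum0 (fun b => P (b :: s))).
  exact: partial_sum_le.
apply: (lt_le_trans h2); rewrite -addrA lerD2l (P_cons s) -partial_sumT.
by rewrite -(partial_sumS (fun b => P (b :: s))); apply: partial_sum_le.
Qed.

Lemma cell_inj a b s x : cell (a :: s) x -> cell (b :: s) x -> a = b.
Proof.
have aux (c d : 'I_q.+1) : (c < d)%N -> cell (c :: s) x -> cell (d :: s) x -> False.
  move=> cd /andP[/= _ h1] /andP[/= h2 _].
  have := lt_le_trans h1 (le_refl _); rewrite -addrA -(partial_sumS (fun b => P (b :: s))) => h.
  have := le_lt_trans h2 h; rewrite ltrD2l ltNge => /negP; apply.
  exact: partial_sum_le.
move=> ha hb; apply/val_inj => /=; case: (ltngtP a b) => // h.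
  by case: (aux _ _ h ha hb).
by case: (aux _ _ h hb ha).
Qed.

Lemma cell_ex s x : cell s x -> exists a, cell (a :: s) x.
Proof.
move=> /andP[h1 h2].
pose f b := P (b :: s).
have ex : exists k, x - cell_left s < partial_sum f k.
  by exists q.+1; rewrite partial_sumT -P_cons ltrBlDl.
(* The letter is the predecessor of the least index whose cumulated weight exceeds the offset of
   [x]; index 0 is excluded because the empty sum is 0. *)
case: (ex_minnP ex) => -[|k] hk kmin; first by move: hk; rewrite partial_sum0 subr_lt0 ltNge h1.
have kq : (k < q.+1)%N.
  by apply: kmin; rewrite partial_sumT -P_cons ltrBlDl.
exists (Ordinal kq); apply/andP; split => /=.
  rewrite -lerBrDl leNgt; apply/negP => /kmin; by rewrite ltnn.
by rewrite -addrA -(partial_sumS f (Ordinal kq)) -ltrBlDl.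
Qed.

(** The default [ord0] arises only when [x] lies in no extension cell of [s], in particular off
    [cell [::]]. *)
Definition next_digit s x := odflt ord0 [pick a | `[< cell (a :: s) x >]].

Fixpoint trace n x := if n is k.+1 then next_digit (trace k x) x :: trace k x else [::].

Lemma next_digitE a s x : cell (a :: s) x -> next_digit s x = a.
Proof.
move=> h; rewrite /next_digit; case: pickP => [b /asboolP hb|/(_ a)/negP[]] /=.
  exact: cell_inj hb h.
exact/asboolP.
Qed.

(** The cells of a given length partition [cell [::]], so the letters read off at [x] spell [s]
    exactly on the cell of [s]. *)
Lemma traceP s x : cell [::] x -> (trace (size s) x = s <-> cell s x).
Proof.
move=> x01; elim: s => [|a s IH] //=; split=> [[h1 h2]|h].
  have /cell_ex[b hb] : cell s x by apply/IH.
  by move: h1; rewrite h2 (next_digitE hb) => <-.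
have -> : trace (size s) x = s by apply/IH/(cell_sub h).
by rewrite (next_digitE h).
Qed.

Lemma size_trace n x : size (trace n x) = n.
Proof. by elim: n => //= n ->. Qed.

Definition digit n x := next_digit (trace n x) x.

Lemma trace_digit s x :
  trace (size s) x = s <-> forall k, (k < size s)%N -> digit k x = nth ord0 (rev s) k.
Proof.
elim: s => [|a s IH] //=; split => [[h1 h2] k|h].
  rewrite ltnS leq_eqVlt rev_cons nth_rcons size_rev => /orP[/eqP ->|ks].
    by rewrite ltnn eqxx.
  by rewrite ks; apply: (IH.1 h2).
have hs : trace (size s) x = s.
  apply/IH => k ks; rewrite h ?ltnS; last exact: ltnW.
  by rewrite rev_cons nth_rcons size_rev ks.
rewrite hs; congr (_ :: _); have := h (size s) (ltnSn _).
by rewrite /digit hs => ->; rewrite rev_cons nth_rcons size_rev ltnn eqxx.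
Qed.

Lemma cellE s : cell s = `[cell_left s, cell_left s + P s[%classic.
Proof. by apply/seteqP; split => x /=; rewrite in_itv. Qed.

Lemma measurable_cell s : measurable (cell s).
Proof. by rewrite cellE. Qed.

Lemma sub_cell s : cell s `<=` cell [::].
Proof. by elim: s => // a s IH x /cell_sub/IH. Qed.

Lemma measurable_digit n a : measurable [set x | digit n x = a].
Proof.
(* Inside [cell [::]] the digit is [a] on a finite union of cells; outside, every digit takes the
   default [ord0]. *)
rewrite (_ : [set x | _] = (\bigcup_(s in [set: n.-tuple 'I_q.+1]) cell (a :: s)) `|`
    (~` cell [::] `&` [set x : R | ord0 = a])).
  apply: measurableU.
    apply: fin_bigcup_measurable => [|s _]; last exact: measurable_cell.
    exact: finite_finset.
  apply: measurableI; first by apply: measurableC; exact: measurable_cell.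
  have [->|na] := eqVneq ord0 a.
    by rewrite (_ : [set x | _] = setT) //; apply/seteqP.
  rewrite (_ : [set x | _] = set0) //.
  by apply/seteqP; split => // x /= /eqP; rewrite (negPf na).
apply/seteqP; split => x /=.
  move=> h; have [x01|nx] := pselect (cell [::] x); [left|right].
    exists (Tuple (introT eqP (size_trace n x))) => //=.
    have /cell_ex[b hb] : cell (trace n x) x by apply/traceP; rewrite ?size_trace.
    by move: h; rewrite /digit (next_digitE hb) => <-.
  split => //; rewrite -h /digit /next_digit; case: pickP => //= b /asboolP.
  by move/sub_cell.
case=> [[s _ h]|[nx <-]].
  have hs : trace (size s) x = s by apply/traceP; [exact: sub_cell h|exact: cell_sub h].
  by move: hs; rewrite size_tuple /digit => ->; exact: next_digitE.
rewrite /digit /next_digit; case: pickP => //= b /asboolP.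
by move/sub_cell.
Qed.

(** The event is the cell of [s], an interval of length [P s]; [rev] restores the order in which the
    letters are drawn. *)
Lemma lebesgue_digit s :
  lebesgue_measure ([set x | forall k, (k < size s)%N -> digit k x = nth ord0 (rev s) k]
     `&` `[0, 1[%classic) = (P s)%:E.
Proof.
rewrite (_ : _ `&` _ = cell s).
  rewrite cellE lebesgue_measure_itv /= lte_fin ltrDl lt_neqAle P_ge0 andbT eq_sym.
  by case: eqP => [->|_] //=; rewrite -EFinB addrC addKr.
have c01 : `[0, 1[%classic = cell [::] by rewrite cellE /= P_nil add0r.
rewrite c01; apply/seteqP; split => x /=.
  by case=> /trace_digit h x01; apply/traceP.
by move=> h; have x01 := sub_cell h; split => //; apply/trace_digit/traceP.
Qed.

End Intervals.

(** * The uniform law on the unit interval *)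

Section UnitLebesgue.
Variable R : realType.

Definition unit_lebesgue := mrestr (@lebesgue_measure R) (measurable_itv `[0, 1[).

HB.instance Definition _ := Measure.on unit_lebesgue.

Let unit_lebesgue_setT : unit_lebesgue setT = 1%E.
Proof. by rewrite /unit_lebesgue /mrestr setTI lebesgue_measure_itv /= lte_fin ltr01 oppr0 adde0. Qed.

HB.instance Definition _ := Measure_isProbability.Build _ _ R unit_lebesgue unit_lebesgue_setT.

End UnitLebesgue.

(** * Cylinders and the law of the walk *)

Section Cylinders.
Variables (R : realType) (r q : nat).
Implicit Types (L : seq (site r)) (xi phi : site r -> 'I_q.+1).

Definition cylinder L xi : set (Omega r q) := [set phi : Omega r q | {in L, phi =1 xi}].

(** Patterns on [L] are tuples, so that sums over them are finite, as in the normalising sum of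
    [gamma]; sites off [L] get the default [ord0]. *)
Definition config L (t : (size L).-tuple 'I_q.+1) : site r -> 'I_q.+1 :=
  fun v => nth ord0 t (index v L).

Lemma measurable_coord (v : site r) i : measurable [set phi : Omega r q | phi v = i].
Proof. by apply: sub_sigma_algebra; exists v, i. Qed.

Lemma eq_cylinder (L L' : seq (site r)) (xi xi' : site r -> 'I_q.+1) :
  L =i L' -> {in L, xi =1 xi'} -> cylinder L xi = cylinder L' xi'.
Proof.
move=> LL' xx; apply/seteqP; split => phi h v vL.
  by rewrite h ?LL' // xx // LL'.
by rewrite h -?LL' // xx.
Qed.

Lemma cylinder_cons v (L : seq (site r)) (xi : site r -> 'I_q.+1) :
  cylinder (v :: L) xi = [set phi | phi v = xi v] `&` cylinder L xi.
Proof.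
apply/seteqP; split => phi /=.
  move=> h; split; first by apply: h; rewrite mem_head.
  by move=> u uL; apply: h; rewrite inE uL orbT.
by case=> h1 h2 u; rewrite inE => /orP[/eqP ->|/h2].
Qed.

Lemma cylinder_nil xi : cylinder [::] xi = setT.
Proof. by apply/seteqP; split. Qed.

Lemma measurable_cylinder L xi : measurable (cylinder L xi).
Proof.
elim: L => [|v L IH]; first by rewrite cylinder_nil.
by rewrite cylinder_cons; apply: measurableI => //; exact: measurable_coord.
Qed.

Lemma config_ex L phi : uniq L -> exists t, {in L, phi =1 @config L t}.
Proof.
move=> uL; exists (map_tuple phi (in_tuple L)) => v vL.
by rewrite /config (nth_map v) ?index_mem // nth_index.
Qed.

Lemma config_inj L t t' : uniq L -> {in L, @config L t =1 @config L t'} -> t = t'.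
Proof.
move=> uL h; apply: eq_from_tnth => k.
have kL : (k < size L)%N by [].
case: L uL t t' h k kL => [|x L] uL t t' h k kL; first by case: k kL.
have := h _ (mem_nth x kL); rewrite /config index_uniq //.
by rewrite -!tnth_nth.
Qed.

Lemma cylinder_disjoint L t t' phi : uniq L ->
  cylinder L (@config L t) phi -> cylinder L (@config L t') phi -> t = t'.
Proof.
by move=> uL h h'; apply: config_inj => // v vL; rewrite -h // h'.
Qed.

Lemma measure_config (mu : {measure set (Omega r q) -> \bar R}) L (A : set (Omega r q)) :
  uniq L -> measurable A ->
  mu A = (\sum_(t : (size L).-tuple 'I_q.+1) mu (A `&` cylinder L (@config L t)))%E.
Proof.
move=> uL mA.
have -> : mu A = mu (\bigcup_(t in [set: (size L).-tuple 'I_q.+1]) (A `&` cylinder L (@config L t))).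
  congr (mu _); apply/seteqP; split => phi /=.
    by move=> Aphi; have [t ht] := config_ex phi uL; exists t.
  by case=> t _ [].
rewrite measure_fin_bigcup //.
- rewrite (fsbigE (index_enum _)) ?index_enum_uniq //.
  + by apply: eq_bigl => t; apply/asboolP.
  + by move=> t _; rewrite mem_index_enum.
- exact: finite_finset.
- move=> t t' _ _ [phi [[_ h] [_ h']]]; exact: cylinder_disjoint uL h h'.
- by move=> t _; apply: measurableI => //; exact: measurable_cylinder.
Qed.

Lemma measure_coord_sum (mu : {measure set (Omega r q) -> \bar R}) A (v : site r) :
  measurable A -> mu A = (\sum_i mu (A `&` [set phi | phi v = i]))%E.
Proof.
move=> mA; rewrite (measure_config mu (L := [:: v])) //.
rewrite (reindex (fun i : 'I_q.+1 => [tuple i])) /=; last first.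
  exists (fun t => thead t) => t _ //.
  by apply/val_inj; case: t => -[|a [|b s]] // st; rewrite /thead (tnth_nth ord0).
apply: eq_bigr => i _; congr (mu (_ `&` _)).
apply/seteqP; split => phi /=.
  by move=> /(_ v (mem_head _ _)) ->; rewrite /config /= eqxx.
by move=> h u; rewrite inE => /eqP ->; rewrite h /config /= eqxx.
Qed.

Definition ballS (S : set (site r)) N := [seq v <- ball r N | `[< S v >]].

Lemma mem_ballS S N v : (v \in ballS S N) = `[< S v >] && (size (word v) <= N)%N.
Proof. by rewrite mem_filter mem_ball. Qed.

Lemma uniq_ballS S N : uniq (ballS S N).
Proof. by rewrite filter_uniq // uniq_ball. Qed.

(** The pattern on the larger list either contradicts or implies the one on the smaller; with the
    empty set added, cylinders over nested lists thus form a pi-system. *)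
Lemma cylinder_setI L L' xi xi' : {subset L <= L'} ->
  cylinder L xi `&` cylinder L' xi' = set0 \/
  cylinder L xi `&` cylinder L' xi' = cylinder L' xi'.
Proof.
move=> LL'; have [h|nh] := pselect {in L, xi' =1 xi}; [right|left].
  apply/seteqP; split => phi /=; first by case.
  by move=> h'; split => // v vL; rewrite h' ?h //; exact: LL'.
apply/seteqP; split => phi //= -[h h']; apply: nh => v vL.
by rewrite -h // h' //; exact: LL'.
Qed.

End Cylinders.

(** * The law of the walk as an image of Lebesgue measure *)

Section Kolmogorov.
Variables (R : realType) (r q : nat) (adj : rel 'I_q.+1) (w : 'I_q.+1 -> R).
Hypotheses (w_gt0 : forall i, 0 < w i) (z_gt0 : forall i, 0 < zw adj w i).
Local Notation z := (zw adj w).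

Definition walk_norm := \sum_i w i * z i.

Lemma walk_norm_gt0 : 0 < walk_norm.
Proof.
rewrite /walk_norm (bigD1 ord0) //= ltr_pwDl ?mulr_gt0 ?sumr_ge0 // => i _.
by rewrite ltW // mulr_gt0.
Qed.

Definition spin_factor (v : site r) (xi : site r -> 'I_q.+1) : R :=
  if v == root r then w (xi v) * z (xi v) / walk_norm
  else (adj (xi (parent v)) (xi v))%:R * (w (xi v) / z (xi (parent v))).

(** [s] holds the spins already drawn, latest first, so [size s] is the breadth-first index of the
    next site and [i] is the spin of its parent. *)
Definition next_weight (s : seq 'I_q.+1) a : R :=
  if s is [::] then w a * z a / walk_norm
  else let i := nth ord0 (rev s) (idx (parent (site_at r (size s)))) in
       (adj i a)%:R * (w a / z i).

Fixpoint prefix_weight s := if s is a :: s' then prefix_weight s' * next_weight s' a else 1.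

Lemma sum_step i : \sum_a (adj i a)%:R * (w a / z i) = 1 :> R.
Proof.
under eq_bigr => a _ do rewrite mulrA.
rewrite -mulr_suml; apply/eqP; rewrite -[X in _ == X](divff (lt0r_neq0 (z_gt0 i))).
apply/eqP; congr (_ / _); rewrite /zw [RHS]big_mkcond; apply: eq_bigr => a _.
by case: (adj i a); rewrite ?mul1r ?mul0r.
Qed.

Lemma sum_next_weight s : \sum_a next_weight s a = 1.
Proof.
case: s => [|b s]; last exact: sum_step.
by rewrite -mulr_suml divff // lt0r_neq0 // walk_norm_gt0.
Qed.

Lemma next_weight_ge0 s a : 0 <= next_weight s a.
Proof.
have w0 i := ltW (w_gt0 i); have z0 i := ltW (z_gt0 i); have Z0 := ltW walk_norm_gt0.
by case: s => [|b s] /=; rewrite ?mulr_ge0 ?divr_ge0 ?mulr_ge0 ?invr_ge0.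
Qed.

Lemma prefix_weight_ge0 s : 0 <= prefix_weight s.
Proof. by elim: s => //= a s IH; rewrite mulr_ge0 ?next_weight_ge0. Qed.

Lemma prefix_weight_cons s : prefix_weight s = \sum_a prefix_weight (a :: s).
Proof. by rewrite /= -mulr_sumr sum_next_weight mulr1. Qed.

(** Every parent precedes its child in the list, so the entry looked up by [next_weight] is the spin
    of the actual parent. *)
Lemma prefix_weightE N n xi : (n <= size (bfs r N))%N ->
  prefix_weight (rev [seq xi v | v <- take n (bfs r N)]) = \prod_(v <- take n (bfs r N)) spin_factor v xi.
Proof.
elim: n => [|n IH] nN; first by rewrite take0 big_nil.
set v := nth (root r) (bfs r N) n.
have iv : idx v = n by exact: nth_bfs.
rewrite (take_nth (root r)) // map_rcons rev_rcons -cats1 big_cat big_seq1 /=.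
rewrite IH; last exact: ltnW.
congr (_ * _); rewrite -/v; set s := rev _.
have ss : size s = n by rewrite size_rev size_map size_takel // ltnW.
rewrite /spin_factor -(inj_eq (@idx_inj r)) idx_root iv.
case: (n =P 0%N) => [n0|/eqP n0].
  by move: ss; rewrite n0 => /size0nil ->.
have vr : v != root r by rewrite -(inj_eq (@idx_inj r)) idx_root iv.
have -> : next_weight s (xi v) = let i := nth ord0 (rev s) (idx (parent (site_at r (size s)))) in
       (adj i (xi v))%:R * (w (xi v) / z i).
  by case: (s) ss => // n0'; rewrite -n0' in n0.
rewrite /= ss -iv site_at_idx.
have ip := idx_parent vr; rewrite iv in ip.
suff -> : nth ord0 (rev s) (idx (parent v)) = xi (parent v) by [].
rewrite /s revK (nth_map (root r)); last by rewrite size_takel // ltnW.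
rewrite nth_take // -(@idx_bfs r N) ?nth_index //.
all: rewrite mem_bfs size_parent (leq_trans (leq_pred _)) // -mem_bfs mem_nth //.
Qed.

Definition sample (x : R) : Omega r q := fun v => digit prefix_weight (idx v) x.

Lemma measurable_sample : @measurable_fun _ _ (measurableTypeR R) (Omega r q) setT sample.
Proof.
apply: (@measurability _ _ (measurableTypeR R) (Omega r q) setT sample (@cyl r q)) => //.
move=> _ [A [v [i ->]] <-]; rewrite setTI.
by apply: measurable_digit => //; [exact: prefix_weight_ge0|exact: prefix_weight_cons].
Qed.

(** The measure is the image of Lebesgue measure under [sample]. All breadth-first prefixes are
    covered, not just balls, so that the law can later be extended one site at a time. *)
Lemma walk_measure : exists mu : probability (Omega r q) R, forall N n xi,
  (n <= size (bfs r N))%N ->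
  mu (cylinder (take n (bfs r N)) xi) = (\prod_(v <- take n (bfs r N)) spin_factor v xi)%:E.
Proof.
pose X : {mfun measurableTypeR R >-> Omega r q} := 
  @mfun_Sub _ _ (measurableTypeR R) (Omega r q) sample (mem_set measurable_sample).
exists (distribution (@unit_lebesgue R) X) => N n xi nN.
rewrite -prefix_weightE // -(lebesgue_digit prefix_weight_ge0 _ prefix_weight_cons) //.
rewrite /distribution /pushforward /unit_lebesgue /mrestr /=.
congr (lebesgue_measure (_ `&` _)); apply/seteqP; split => x /= h.
  move=> k; rewrite revK size_rev size_map size_takel // => kn.
  rewrite (nth_map (root r)) ?size_takel // nth_take //.
  have kN := leq_trans kn nN.
  rewrite -h /sample ?nth_bfs //.
  by rewrite -(nth_take _ kn) mem_nth // size_takel.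
move=> v vL; rewrite /sample.
have := h (index v (take n (bfs r N))).
rewrite revK size_rev size_map index_mem => /(_ vL).
rewrite (nth_map v) ?index_mem // nth_index // => <-; congr (digit _ _ _).
rewrite -(@idx_bfs r N); last exact: mem_take vL.
by rewrite -{1}(cat_take_drop n (bfs r N)) index_cat vL.
Qed.

End Kolmogorov.

(** * Agreement on generated sigma-algebras; the two sides of an edge *)

Section CoordSigma.
Variables (R : realType) (r q : nat).
Implicit Types (S : set (site r)) (A : set (Omega r q)).

Lemma coord_sigma_measurable S A : coord_sigma S A -> measurable A.
Proof.
apply: smallest_sub; first exact: sigma_algebra_measurable.
by move=> _ [v [i [_ ->]]]; exact: measurable_coord.
Qed.

Lemma coord_sigma_subset S S' : S `<=` S' -> @coord_sigma r q S `<=` coord_sigma S'.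
Proof.
move=> SS'; apply: smallest_sub; first exact: smallest_sigma_algebra.
by move=> _ [v [i [Sv ->]]]; apply: sub_sigma_algebra; exists v, i; split=> //; exact: SS'.
Qed.

Lemma coord_sigma_coord S v i : S v -> coord_sigma S [set phi : Omega r q | phi v = i].
Proof. by move=> Sv; apply: sub_sigma_algebra; exists v, i. Qed.

Lemma coord_sigmaT S : @coord_sigma r q S setT.
Proof.
by apply: (@measurableT _ (g_sigma_algebraType [set A | exists v i, S v /\ A = [set f : Omega r q | f v = i]])).
Qed.

Lemma coord_sigmaI S A B : coord_sigma S A -> coord_sigma S B -> coord_sigma S (A `&` B).
Proof.
exact: (@measurableI _ (g_sigma_algebraType [set A | exists v i, S v /\ A = [set f : Omega r q | f v = i]])).
Qed.

Lemma coord_sigma_cylinder S L xi :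
  (forall v, v \in L -> S v) -> coord_sigma S (@cylinder r q L xi).
Proof.
elim: L => [|v L IH] LS; first by rewrite cylinder_nil; exact: coord_sigmaT.
rewrite cylinder_cons; apply: coord_sigmaI.
  by apply: coord_sigma_coord; apply: LS; rewrite mem_head.
by apply: IH => u uL; apply: LS; rewrite inE uL orbT.
Qed.

(** The pi-lambda theorem for cylinders over the parts of balls in [S]. The threshold [N0] lets the
    agreement be checked on large balls only. *)
Lemma coord_sigma_unique (m1 m2 : {measure set (Omega r q) -> \bar R}) S N0 :
  (m1 setT < +oo)%E ->
  (forall N xi, (N0 <= N)%N -> m1 (cylinder (ballS S N) xi) = m2 (cylinder (ballS S N) xi)) ->
  forall A, coord_sigma S A -> m1 A = m2 A.
Proof.
move=> m1oo m12 A SA.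
pose G := [set B : set (Omega r q) | B = set0 \/ B = setT \/
  exists N xi, (N0 <= N)%N /\ B = cylinder (ballS S N) xi].
have mG : G `<=` measurable.
  move=> B [->|[->|[N [xi [_ ->]]]]] //; exact: measurable_cylinder.
have IG : setI_closed G.
  move=> B C [->|[->|[N [xi [N0N ->]]]]]; [by rewrite set0I; left|by rewrite setTI|].
  case=> [->|[->|[M [eta [N0M ->]]]]]; [by rewrite setI0; left|by rewrite setIT; right; right; exists N, xi|].
  have sub K K' : (K <= K')%N -> {subset ballS S K <= ballS S K'}.
    by move=> KK' v; rewrite !mem_ballS => /andP[-> /leq_trans]; exact.
  have [NM|MN] := leqP N M.
    by have [->|->] := cylinder_setI xi eta (sub _ _ NM); [left|right; right; exists M, eta].
  rewrite setIC; have [->|->] := cylinder_setI eta xi (sub _ _ (ltnW MN)).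
    by left.
  by right; right; exists N, xi.
apply: (@g_sigma_algebra_measure_unique _ R (Omega r q) G mG (fun=> setT)) => //.
- by move=> _; right; left.
- by rewrite bigcup_const //; exists 0%N.
- move=> B [->|[->|[N [xi [N0N ->]]]]]; [by rewrite !measure0| |exact: m12].
  rewrite !(@measure_config _ _ _ _ (ballS S N0)) ?uniq_ballS //.
  by apply: eq_bigr => t _; rewrite !setTI m12.
- move: A SA; apply: smallest_sub; first exact: smallest_sigma_algebra.
  move=> _ [v [i [Sv ->]]].
  (* A coordinate event is a finite union of cylinders over any ball that contains the site. *)
  pose N := maxn N0 (size (word v)).
  have vN : v \in ballS S N by rewrite mem_ballS leq_maxr andbT; exact/asboolP.
  rewrite (_ : [set f | _] = \bigcup_(t in [set t : (size (ballS S N)).-tuple 'I_q.+1 |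
      @config _ _ (ballS S N) t v = i]) cylinder (ballS S N) (@config _ _ (ballS S N) t)).
    apply: (@fin_bigcup_measurable _ (g_sigma_algebraType G)).
      exact: finite_finset.
    move=> t _; apply: sub_sigma_algebra; right; right; exists N, (@config _ _ (ballS S N) t).
    by rewrite leq_maxl.
  apply/seteqP; split => phi /=; last by move=> [t <-]; exact.
  move=> pv; have [t ht] := config_ex phi (uniq_ballS S N).
  by exists t => //=; rewrite -ht.
Qed.

(** Uniqueness applied to two scaled restrictions of [mu]; it carries product identities from
    cylinders to a whole sigma-algebra. *)
Lemma coord_sigma_scaled (mu : probability (Omega r q) R) S N0 (X Y : set (Omega r q)) (a b : R) :
  measurable X -> measurable Y -> 0 <= a -> 0 <= b ->
  (forall N xi, (N0 <= N)%N ->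
    (a%:E * mu (cylinder (ballS S N) xi `&` X) = b%:E * mu (cylinder (ballS S N) xi `&` Y))%E) ->
  forall A, coord_sigma S A -> (a%:E * mu (A `&` X) = b%:E * mu (A `&` Y))%E.
Proof.
move=> mX mY a0 b0 h A SA.
apply: (@coord_sigma_unique (mscale (NngNum a0) (mrestr mu mX)) (mscale (NngNum b0) (mrestr mu mY)) S N0) SA.
  rewrite -ge0_fin_numE ?measure_ge0 //.
  by rewrite [X in X \is a _](_ : _ = (a%:E * mu (setT `&` X))%E) // setTI fin_numM // fin_num_measure.
by move=> N xi NN; exact: h.
Qed.

End CoordSigma.

Section Sides.
Variable r : nat.
Implicit Types u v c x y : site r.

Definition desc c v := prefix (word c) (word v).

Lemma desc_refl c : desc c c. Proof. exact: prefix_refl. Qed.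

(** Deleting the last letter destroys the prefix [word c] only when nothing follows it, that is, for
    v = c. *)
Lemma desc_parent c v : c != root r -> v != c -> desc c (parent v) = desc c v.
Proof.
rewrite -size_gt0 => c0 vc; rewrite /desc !prefixE word_parent /droplast.
have [le|lt] := leqP (size (word c)) (size (word v)).-1.
  by rewrite take_takel.
rewrite [take (size (word c)) (take _ _)]take_oversize ?size_takel ?leq_pred //; last exact: ltnW.
rewrite [RHS](_ : _ = false); last first.
  rewrite take_oversize; last by case: (size (word v)) lt.
  by apply: contraNF vc => /eqP h; apply/eqP/val_inj.
apply/eqP => h; have := size_takel (leq_pred (size (word v))).
by rewrite h => hs; move: lt; rewrite hs ltnn.
Qed.

Lemma desc_cross c x y : c != root r -> tadj x y -> desc c x -> ~~ desc c y ->
  x = c /\ y = parent c.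
Proof.
move=> cr /orP[]; rewrite childE => /andP[yr /eqP ->].
  have [->|yc] := eqVneq y c; first by rewrite desc_refl.
  by rewrite desc_parent // => ->.
have [-> //|xc] := eqVneq x c.
by rewrite desc_parent // => ->.
Qed.

Lemma desc_parentN c : c != root r -> ~~ desc c (parent c).
Proof.
move=> cr; apply/negP => /size_prefix; rewrite size_parent.
by move: cr; rewrite -size_gt0; case: (size _) => // n _; rewrite /= ltnn.
Qed.

Definition side u v x := if child u v then desc v x else ~~ desc u x.

Lemma child_asym u v : child u v -> child v u = false.
Proof.
rewrite !childE => /andP[vr /eqP ->]; apply/negP => /andP[_ /eqP h].
have := size_parent (parent v); rewrite -h size_parent.
by move: vr; rewrite -size_gt0; lia.
Qed.

(* [side u v] is the component of the tree minus the edge [u v] containing [v]. *)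
Lemma sideP u v : tadj u v -> exists2 c, c != root r &
  (v = c /\ u = parent c /\ side u v =1 desc c) \/
  (u = c /\ v = parent c /\ side u v =1 predC (desc c)).
Proof.
move=> /orP[h|h]; have := h; rewrite childE => /andP[cr /eqP pE].
  by exists v => //; left; do !split => //; move=> x; rewrite /side h.
by exists u => //; right; do !split => //; move=> x; rewrite /side (child_asym h).
Qed.

Lemma side_end u v : tadj u v -> side u v v /\ ~~ side u v u.
Proof.
move=> /sideP[c cr [[-> [-> E]]|[-> [-> E]]]]; rewrite !E /=.
  by rewrite desc_refl desc_parentN.
by rewrite desc_refl desc_parentN.
Qed.

Lemma side_cross u v x y : tadj u v -> tadj x y -> side u v x -> ~~ side u v y ->
  x = v /\ y = u.
Proof.
move=> /sideP[c cr [[-> [-> E]]|[-> [-> E]]]]; rewrite !E /=.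
  exact: desc_cross.
by rewrite negbK tadj_sym => xy dx dy; have [] := desc_cross cr xy dy dx.
Qed.

(** A path from [v] that avoids [u] never uses the edge [u v], the only one joining the two
    sides. *)
Lemma comp_sub_side u v x : tadj u v -> comp u v x -> side u v x.
Proof.
move=> uv [p [pp <-]]; have [vv _] := side_end uv; move: pp vv.
have H : forall x', path (@tadj r) x' p -> side u v x' -> u \notin x' :: p -> side u v (last x' p); last exact: H.
elim: p => [|y p IH] x' //= /andP[xy yp] sx.
rewrite !inE !negb_or => /and3P[ux uy up].
apply: IH => //; last by rewrite inE negb_or uy.
apply/negPn/negP => ny; have [_ /eqP] := side_cross uv xy sx ny.
by rewrite eq_sym (negPf uy).
Qed.

(** The neighbour [v'] is on the side of [u], and a path from it could cross over only by passing
    through [u]. *)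
Lemma comp_other_side u v v' x : tadj u v -> tadj u v' -> v' != v ->
  comp u v' x -> ~~ side u v x.
Proof.
move=> uv uv' vv' [p [pp <-]]; have [_ nu] := side_end uv.
have nv' : ~~ side u v v'.
  apply/negP => h; rewrite tadj_sym in uv'; have [/eqP] := side_cross uv uv' h nu.
  by rewrite (negPf vv').
move: pp nv'.
have H : forall x', path (@tadj r) x' p -> ~~ side u v x' -> u \notin x' :: p ->
  ~~ side u v (last x' p); last exact: H.
elim: p => [|y p IH] x' //= /andP[xy yp] sx.
rewrite !inE !negb_or => /and3P[ux uy up].
apply: IH => //; last by rewrite inE negb_or uy.
apply/negP => ny; rewrite tadj_sym in xy; have [_ /eqP] := side_cross uv xy ny sx.
by rewrite eq_sym (negPf ux).
Qed.

End Sides.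

(** * Independence across an edge *)

Section Walk.
Variables (R : realType) (r q : nat) (adj : rel 'I_q.+1) (w : 'I_q.+1 -> R).
Variable mu : probability (Omega r q) R.
Local Notation z := (zw adj w).
Local Notation spin_factor := (@spin_factor R r q adj w).
Hypothesis mu_law : forall N n xi, (n <= size (bfs r N))%N ->
  mu (cylinder (take n (bfs r N)) xi) = (\prod_(v <- take n (bfs r N)) spin_factor v xi)%:E.

Lemma mu_ball N xi : mu (cylinder (ball r N) xi) = (\prod_(v <- ball r N) spin_factor v xi)%:E.
Proof.
rewrite (perm_big _ (perm_bfs r N)) /=.
rewrite -[bfs r N]take_size -mu_law // take_size; congr (mu _).
by apply/seteqP; split => phi h v; [rewrite -(perm_mem (perm_bfs r N))|rewrite (perm_mem (perm_bfs r N))]; exact: h.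
Qed.

(** A single implication suffices because [phi] and [phi'] can be exchanged. *)
Definition determined (S : set (site r)) N (A : set (Omega r q)) :=
  forall phi phi' : Omega r q, (forall v, v \in ball r N -> S v -> phi v = phi' v) ->
    A phi -> A phi'.

Lemma determinedP S N A (phi phi' : Omega r q) : determined S N A ->
  (forall v, v \in ball r N -> S v -> phi v = phi' v) -> `[< A phi >] = `[< A phi' >].
Proof.
move=> dA h; apply/asboolP/asboolP; apply: dA => // v vN Sv.
by rewrite h.
Qed.

Lemma determined_cylinder S N M xi : (M <= N)%N -> determined S N (cylinder (ballS S M) xi).
Proof.
move=> MN phi phi' h hphi v vM; rewrite -hphi // h //.
  by move: vM; rewrite mem_ballS mem_ball => /andP[_ /leq_trans]; exact.
by move: vM; rewrite mem_ballS => /andP[/asboolP].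
Qed.

Lemma determined_coord S N v i : S v -> v \in ball r N ->
  determined S N [set phi : Omega r q | phi v = i].
Proof. by move=> Sv vN phi phi' h /= <-; rewrite h. Qed.

Lemma determined_subset S S' N A : S `<=` S' -> determined S N A -> determined S' N A.
Proof. by move=> SS' dA phi phi' h; apply: dA => v vN Sv; apply: h => //; exact: SS'. Qed.

Lemma determinedI S N A B : determined S N A -> determined S N B -> determined S N (A `&` B).
Proof. by move=> dA dB phi phi' h [/(dA _ _ h) ? /(dB _ _ h)]. Qed.

Local Notation conf N := ((size (ball r N)).-tuple 'I_q.+1).
Local Notation cf N := (@config r q (ball r N)).
Local Notation density N t := (\prod_(v <- ball r N) spin_factor v (cf N t)).

Lemma mu_determined N (A : set (Omega r q)) : measurable A -> determined setT N A ->
  mu A = (\sum_(t : conf N) `[< A (cf N t) >]%:R * density N t)%:E.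
Proof.
move=> mA dA; rewrite (measure_config _ (uniq_ball r N) mA) -sumEFin.
apply: eq_bigr => t _; case: asboolP => h.
  rewrite mul1r -mu_ball; congr (mu _); apply/seteqP; split => phi /=; first by case.
  by move=> hphi; split => //; apply: dA h => v vN _; rewrite hphi.
rewrite mul0r (_ : _ `&` _ = set0) ?measure0 //.
apply/seteqP; split => phi //= -[Aphi hphi]; apply: h.
by apply: dA Aphi => v vN _; rewrite hphi.
Qed.

Definition mix_config N (D : pred (site r)) (t t' : conf N) : conf N :=
  map_tuple (fun v => if D v then cf N t v else cf N t' v) (in_tuple (ball r N)).

Lemma config_mix_config N D (t t' : conf N) v : v \in ball r N ->
  cf N (mix_config D t t') v = if D v then cf N t v else cf N t' v.
Proof.
by move=> vN; rewrite {1}/config /mix_config /= (nth_map v) ?index_mem // nth_index.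
Qed.

Definition swap_config N D (p : conf N * conf N) := (mix_config D p.1 p.2, mix_config D p.2 p.1).

Lemma swap_configK N D : involutive (@swap_config N D).
Proof.
move=> [t t']; rewrite /swap_config /=; congr (_, _); apply: (config_inj (uniq_ball r N)) => v vN.
  by rewrite !config_mix_config //; case: (D v).
by rewrite !config_mix_config //; case: (D v).
Qed.

Lemma spin_factor_ext v (xi xi' : site r -> 'I_q.+1) :
  xi v = xi' v -> xi (parent v) = xi' (parent v) -> spin_factor v xi = spin_factor v xi'.
Proof. by rewrite /spin_factor => -> ->. Qed.

(** A factor involves only [v] and its parent, which lie on the same side unless [v = c]; in that
    case agreement at one end of the edge supplies the missing spin. *)
Lemma spin_factor_swap N c x (t t' : conf N) v : c != root r -> c \in ball r N ->
  x = c \/ x = parent c -> cf N t x = cf N t' x -> v \in ball r N ->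
  spin_factor v (cf N (mix_config (desc c) t t')) * spin_factor v (cf N (mix_config (desc c) t' t)) =
  spin_factor v (cf N t) * spin_factor v (cf N t').
Proof.
move=> cr cN xc tx vN.
have pN : parent v \in ball r N.
  by move: vN; rewrite !mem_ball size_parent; apply: leq_trans; exact: leq_pred.
have [vc|vc] := eqVneq v c; last first.
  have := desc_parent cr vc; case: (boolP (desc c v)) => dv dp.
    by congr (_ * _); apply: spin_factor_ext; rewrite config_mix_config // ?dv ?dp.
  by rewrite mulrC; congr (_ * _); apply: spin_factor_ext; rewrite config_mix_config // ?(negPf dv) ?dp.
have [dc dp] : desc c v /\ desc c (parent v) = false.
  by rewrite vc desc_refl (negPf (desc_parentN cr)).
case: xc => xE.
  rewrite mulrC; congr (_ * _); apply: spin_factor_ext; rewrite config_mix_config // ?dc ?dp //.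
    by rewrite vc -xE tx.
  by rewrite vc -xE tx.
congr (_ * _); apply: spin_factor_ext; rewrite config_mix_config // ?dc ?dp //.
  by rewrite vc -xE tx.
by rewrite vc -xE tx.
Qed.

(* Exchanging the configurations of two copies below [c] preserves the product
   measure restricted to the event that both copies agree at [x]. *)
Lemma desc_indep_ball N c x i (A B : set (Omega r q)) :
  c != root r -> c \in ball r N -> x = c \/ x = parent c ->
  measurable A -> measurable B ->
  determined [set v | desc c v] N A -> determined (~` [set v | desc c v]) N B ->
  let E := [set phi : Omega r q | phi x = i] in
  (mu E * mu (A `&` (B `&` E)) = mu (B `&` E) * mu (A `&` E))%E.
Proof.
move=> cr cN xc mA mB dA dB E.
have xN : x \in ball r N.
  case: xc => -> //; move: cN; rewrite !mem_ball size_parent.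
  by apply: leq_trans; exact: leq_pred.
have mE : measurable E by exact: measurable_coord.
have dE : determined setT N E by exact: determined_coord.
have dA' : determined setT N A by apply: determined_subset dA.
have dB' : determined setT N B by apply: determined_subset dB.
rewrite !(@mu_determined N) //; do ?[by do ?apply: measurableI | by do ?apply: determinedI].
rewrite -!EFinM; congr EFin; rewrite !big_distrlr /= !pair_bigA /=.
rewrite [RHS](reindex_inj (inv_inj (@swap_configK N (desc c)))) /=.
apply: eq_bigr => -[t t'] _ /=.
rewrite !asbool_and.
have aE : `[< A (cf N (mix_config (desc c) t' t)) >] = `[< A (cf N t') >].
  by apply: (determinedP dA) => v vN /= dv; rewrite config_mix_config // dv.
have bE : `[< B (cf N (mix_config (desc c) t t')) >] = `[< B (cf N t') >].
  by apply: (determinedP dB) => v vN /= /negP/negPf dv; rewrite config_mix_config // dv.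
rewrite aE bE.
have eE s : `[< E (cf N s) >] = (cf N s x == i) by apply/asboolP/eqP.
rewrite !eE !config_mix_config //.
(* Unless both copies have spin [i] at [x], the terms on both sides vanish. *)
have [e1|n1] := eqVneq (cf N t x) i; last first.
  by case: (desc c x); rewrite /= ?(negPf n1) ?andbF /= !(mulr0n, mul0r, mulr0).
have [e2|n2] := eqVneq (cf N t' x) i; last first.
  by case: (desc c x); rewrite /= ?(negPf n2) ?andbF /= !(mulr0n, mul0r, mulr0).
have gE : density N (mix_config (desc c) t t') * density N (mix_config (desc c) t' t) = density N t * density N t'.
  rewrite -!big_split big_seq [RHS]big_seq; apply: eq_bigr => v vN /=.
  by apply: (spin_factor_swap cr cN xc) => //; rewrite e1 e2.
have -> : (if desc c x then cf N t x else cf N t' x) = i by case: ifP.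
have -> : (if desc c x then cf N t' x else cf N t x) = i by case: ifP.
rewrite eqxx !andbT mul1r [RHS]mulrACA gE -mulnb natrM; ring.
Qed.

Lemma desc_indep c x i (A B : set (Omega r q)) :
  c != root r -> x = c \/ x = parent c ->
  coord_sigma [set v | desc c v] A -> coord_sigma (~` [set v | desc c v]) B ->
  let E := [set phi : Omega r q | phi x = i] in
  (mu E * mu (A `&` (B `&` E)) = mu (B `&` E) * mu (A `&` E))%E.
Proof.
move=> cr xc sA sB E.
have mA := coord_sigma_measurable sA; have mB := coord_sigma_measurable sB.
have mE : measurable E by exact: measurable_coord.
have muE X : measurable X -> mu X = (fine (mu X))%:E by move=> mX; rewrite fineK // fin_num_measure.
have f0 X : 0 <= fine (mu X) by rewrite fine_ge0.
have mI := @measurableI _ (Omega r q).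
have mEA X : measurable X -> measurable (X `&` E) by move=> mX; apply: measurableI.
rewrite (muE E) // (muE (B `&` E)); last exact: mEA.
apply: (coord_sigma_scaled (S := [set v | desc c v]) (N0 := size (word c))) => //; first exact: mEA.
move=> N xi cN; set C := cylinder _ xi.
have mC : measurable C by exact: measurable_cylinder.
rewrite -(muE E) // -(muE (B `&` E)); last exact: mEA.
(* The identity is extended first in [B], with a cylinder in place of [A], and then in [A]; radii at
   least [N] put both cylinders in one ball. *)
have inner : ((fine (mu E))%:E * mu (B `&` (C `&` E)) = (fine (mu (C `&` E)))%:E * mu (B `&` E))%E.
  apply: (coord_sigma_scaled (S := ~` [set v | desc c v]) (N0 := N)) => //; first exact: mEA.
  move=> M eta NM; rewrite -(muE E) // -(muE (C `&` E)); last exact: mEA.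
  rewrite setICA [RHS]muleC.
  apply: (@desc_indep_ball M c x i C _ cr _ xc mC).
  - by rewrite mem_ball (leq_trans cN).
  - exact: measurable_cylinder.
  - exact: determined_cylinder.
  - exact: determined_cylinder.
by rewrite (muE E) // (setICA C) inner -(muE _ (mEA _ mC)) muleC.
Qed.

Lemma side_indep u v i (A B : set (Omega r q)) : tadj u v ->
  coord_sigma [set x | side u v x] A -> coord_sigma (~` [set x | side u v x]) B ->
  let E := [set phi : Omega r q | phi u = i] in
  (mu E * mu (A `&` (B `&` E)) = mu (B `&` E) * mu (A `&` E))%E.
Proof.
move=> uv sA sB E.
have [c cr [[vc [uc sE]]|[uc [vc sE]]]] := sideP uv.
  have e : [set x | side u v x] = [set x | desc c x] by apply/seteqP; split => x /=; rewrite sE.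
  rewrite e in sA sB; apply: (@desc_indep c u i A B cr _ sA sB).
  by right; rewrite uc.
have e : [set x | side u v x] = ~` [set x | desc c x].
  by apply/seteqP; split => x /=; rewrite sE /= => /negP.
rewrite e in sA; rewrite e setCK in sB.
rewrite setICA [RHS]muleC.
by apply: (@desc_indep c u i B A cr _ sB sA); left.
Qed.

End Walk.

(** * Simplicity and invariance *)

Section Admissible.
Variable r : nat.

(** Newest site first: a finite subtree grown by one neighbour at a time from any starting site.
    Automorphisms preserve this notion, whereas breadth-first lists are tied to the root. *)
Inductive admissible : seq (site r) -> Prop :=
| AdmOne x : admissible [:: x]
| AdmCons u v L : admissible L -> v \notin L -> u \in L -> tadj u v -> admissible (v :: L).

(** At the moment when the growing list first meets both [D] and its complement, the new site and
    the neighbour it is attached to form the crossing edge. *)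
Lemma admissible_cross (D : pred (site r)) L : admissible L -> has D L -> ~~ all D L ->
  exists x y, [/\ x \in L, y \in L, tadj x y, D x & ~~ D y].
Proof.
elim=> [x|u v L' aL IH vL uL uv] /=; first by rewrite orbF andbT => ->.
have [DL|nDL] := boolP (has D L').
  have [aD|naD] := boolP (all D L').
    rewrite andbT => _ nDv; exists u, v; split => //.
    - by rewrite inE uL orbT.
    - by rewrite mem_head.
    - exact: (allP aD).
  by move=> _ _; have [x [y [xL yL xy Dx Dy]]] := IH DL naD; exists x, y; rewrite !inE xL yL !orbT.
rewrite orbF => Dv _; exists v, u; split => //.
- by rewrite mem_head.
- by rewrite inE uL orbT.
- by rewrite tadj_sym.
- by move: nDL => /hasPn; exact.
Qed.

(** A list reaching both sides of the edge [u v] must contain a crossing edge, hence [v] itself. *)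
Lemma admissible_side L u v x : admissible L -> v \notin L -> u \in L -> tadj u v ->
  x \in L -> ~~ side u v x.
Proof.
move=> aL vL uL uv xL; apply/negP => sx.
have hD : has (side u v) L by apply/hasP; exists x.
have nD : ~~ all (side u v) L.
  by apply/negP => /allP/(_ _ uL); have [_ /negPf ->] := side_end uv.
have [a [b [aL' _ ab sa sb]]] := admissible_cross aL hD nD.
by have [av _] := side_cross uv ab sa sb; rewrite -av aL' in vL.
Qed.

Lemma admissible_bfs N n : (0 < n)%N -> (n <= size (bfs r N))%N -> admissible (rev (take n (bfs r N))).
Proof.
case: n => // n _; elim: n => [|n IH] nN.
  by case: (bfs r N) nN => // x s _; rewrite /= take0; exact: AdmOne.
set v := nth (root r) (bfs r N) n.+1.
have iv : idx v = n.+1 by exact: nth_bfs.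
have vr : v != root r by rewrite -(inj_eq (@idx_inj r)) idx_root iv.
rewrite (take_nth (root r)) // rev_rcons -/v.
have ip := idx_parent vr; rewrite iv in ip.
apply: (@AdmCons (parent v)); first exact/IH/ltnW.
- rewrite mem_rev; apply/negP => /(nthP (root r))[k]; rewrite size_takel; last exact: ltnW.
  move=> kn; rewrite nth_take // => kv.
  have := congr1 (@idx r) kv; rewrite nth_bfs ?iv; last exact: ltn_trans nN.
  by move=> kE; rewrite kE ltnn in kn.
- rewrite mem_rev.
  have pv : parent v \in bfs r N.
    by rewrite mem_bfs size_parent (leq_trans (leq_pred _)) // -mem_bfs mem_nth.
  rewrite -(nth_index (root r) pv) idx_bfs // -(nth_take (root r) ip).
  by rewrite mem_nth // size_takel // ltnW.
- by rewrite /tadj child_parent.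
Qed.

Lemma admissible_map s L : automorphism s -> admissible L -> admissible (map s L).
Proof.
move=> [bs hs]; elim=> [x|u v L' aL IH vL uL uv]; first exact: AdmOne.
apply: (@AdmCons (s u)) => //; last by rewrite hs.
  by rewrite mem_map //; exact: bij_inj.
by apply: map_f.
Qed.

End Admissible.

Lemma bigcap_nil (T : Type) (I : eqType) (A : I -> set T) :
  \bigcap_(x in [set x | x \in [::]]) A x = setT.
Proof. by apply/seteqP; split. Qed.

Lemma bigcap_cons (T : Type) (I : eqType) (A : I -> set T) i s :
  \bigcap_(x in [set x | x \in i :: s]) A x = A i `&` \bigcap_(x in [set x | x \in s]) A x.
Proof.
apply/seteqP; split => t /= h.
  split; first by apply: h; rewrite /= mem_head.
  by move=> x xs; apply: h; rewrite /= inE xs orbT.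
by case: h => h1 h2 x /=; rewrite inE => /orP[/eqP ->|/h2].
Qed.

Lemma coord_sigma_bigcap r q (S : set (site r)) (vs : seq (site r)) (A : site r -> set (Omega r q)) :
  (forall v, v \in vs -> coord_sigma S (A v)) ->
  coord_sigma S (\bigcap_(v in [set v | v \in vs]) A v).
Proof.
elim: vs => [|v vs IH] sA; first by rewrite bigcap_nil; exact: coord_sigmaT.
rewrite bigcap_cons; apply: coord_sigmaI; first by apply: sA; rewrite mem_head.
by apply: IH => x xvs; apply: sA; rewrite inE xvs orbT.
Qed.

(** * Marginals of the walk and their consequences *)

Section WalkMarginals.
Variables (R : realType) (r q : nat) (adj : rel 'I_q.+1) (w : 'I_q.+1 -> R).
Hypothesis adj_sym : symmetric adj.
Hypotheses (w_gt0 : forall i, 0 < w i) (z_gt0 : forall i, 0 < zw adj w i).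
Variable mu : probability (Omega r q) R.
Local Notation z := (zw adj w).
Local Notation spin_factor := (@spin_factor R r q adj w).
Local Notation walk_norm := (@walk_norm R q adj w).
Local Notation at_ v i := [set phi : Omega r q | phi v = i].
Hypothesis mu_law : forall N n xi, (n <= size (bfs r N))%N ->
  mu (cylinder (take n (bfs r N)) xi) = (\prod_(v <- take n (bfs r N)) spin_factor v xi)%:E.

Let muE X : measurable X -> mu X = (fine (mu X))%:E.
Proof. by move=> mX; rewrite fineK // fin_num_measure. Qed.

Let mu_config L (A : set (Omega r q)) : uniq L -> measurable A ->
  mu A = (\sum_(t : (size L).-tuple 'I_q.+1) mu (A `&` cylinder L (@config r q L t)))%E.
Proof. exact: measure_config. Qed.

Let mu_coord_sum (A : set (Omega r q)) v : measurable A ->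
  mu A = (\sum_i mu (A `&` at_ v i))%E.
Proof. exact: measure_coord_sum. Qed.

Let step i j : R := (adj i j)%:R * (w j / z i).

Lemma root_marginal i : mu (at_ (root r) i) = (w i * z i / walk_norm)%:E.
Proof.
have bfs0 : bfs r 0 = [:: root r] by exact: level0.
have := @mu_law 0 1 (fun=> i); rewrite bfs0 => /(_ isT).
rewrite /= ?take0 big_seq1 /spin_factor eqxx => <-; congr (mu _).
apply/seteqP; split => phi /=; first by move=> h u; rewrite inE => /eqP ->.
by apply; rewrite mem_head.
Qed.

(** The law is split over the patterns on the sites preceding [c]; adding [c] multiplies each term
    by its transition probability. *)
Lemma child_step c i j : c != root r ->
  mu (at_ c j `&` at_ (parent c) i) = ((step i j)%:E * mu (at_ (parent c) i))%E.
Proof.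
move=> cr; set N := size (word c).
have cN : c \in bfs r N by rewrite mem_bfs.
have nN : (idx c < size (bfs r N))%N by rewrite -(idx_bfs cN) index_mem.
set L := take (idx c) (bfs r N).
have LE : take (idx c).+1 (bfs r N) = rcons L c.
  by rewrite (take_nth (root r)) // -(idx_bfs cN) nth_index.
have cL : c \notin L.
  have := uniq_bfs r N; rewrite -(cat_take_drop (idx c).+1 (bfs r N)) LE cat_uniq.
  by rewrite rcons_uniq => /andP[/andP[]].
have pL : parent c \in L.
  have pN : parent c \in bfs r N by rewrite mem_bfs size_parent leq_pred.
  rewrite -(nth_index (root r) pN) idx_bfs // -(nth_take (root r) (idx_parent cr)).
  by rewrite mem_nth // size_takel ?idx_parent // ltnW.
have pc : parent c != c by apply: contraNneq cL => <-.
have uL : uniq L by rewrite take_uniq // uniq_bfs.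
have mI := measurableI.
rewrite (mu_config uL) //; last by apply: measurableI; exact: measurable_coord.
rewrite [in RHS](mu_config uL) //; last exact: measurable_coord.
rewrite ge0_sume_distrr; last by move=> t _; exact: measure_ge0.
apply: eq_bigr => t _; set xi := config t.
have [xp|xp] := eqVneq (xi (parent c)) i; last first.
  rewrite (_ : _ `&` _ `&` _ = set0); last first.
    by apply/seteqP; split => phi //= -[[_ h] /(_ _ pL) h']; move: xp; rewrite -h' h eqxx.
  rewrite (_ : _ `&` _ = set0) ?measure0 ?mule0 //.
  by apply/seteqP; split => phi //= -[h /(_ _ pL) h']; move: xp; rewrite -h' h eqxx.
have -> : at_ (parent c) i `&` cylinder L xi = cylinder L xi.
  by apply: setIidr => phi /(_ _ pL); rewrite xp.
pose xi' v := if v == c then j else xi v.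
have xx : {in L, xi' =1 xi}.
  by move=> v vL; rewrite /xi'; case: eqP vL cL => // -> ->.
have -> : at_ c j `&` at_ (parent c) i `&` cylinder L xi = cylinder (take (idx c).+1 (bfs r N)) xi'.
  rewrite LE (@eq_cylinder r q (rcons L c) (c :: L) xi' xi') //; last by move=> v; rewrite mem_rcons.
  rewrite cylinder_cons (@eq_cylinder _ _ L L xi' xi) // /xi' eqxx -setIA; congr (_ `&` _).
  by apply: setIidr => phi /(_ _ pL); rewrite xp.
rewrite /L !mu_law //; last exact: ltnW.
rewrite -/L LE -cats1 big_cat big_seq1 /= mulrC EFinM; congr (_%:E * _%:E)%E.
  by rewrite /spin_factor (negPf cr) /xi' eqxx (negPf pc) xp.
(* No site listed before [c] has [c] as its parent, so the other factors do not see the spin put at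
   [c]. *)
rewrite big_seq [RHS]big_seq; apply: eq_bigr => v vL; apply: spin_factor_ext; first exact: xx.
rewrite /xi'; case: eqP => // pv; exfalso.
have vr : v != root r by apply: contraNneq cr => vr; move: pv; rewrite vr parent_root => ->.
have iv := idx_parent vr; rewrite pv in iv.
move: vL => /(nthP (root r))[k]; rewrite size_takel; last exact: ltnW.
move=> kc; rewrite nth_take // => kv.
have kE : idx v = k by rewrite -kv nth_bfs // (ltn_trans kc).
by move: iv; rewrite kE ltnNge ltnW.
Qed.

Lemma walk_norm_neq0 : walk_norm != 0.
Proof. by rewrite gt_eqF // walk_norm_gt0. Qed.

(** Induction on the level: by symmetry of [adj], the law proportional to w_i z_i is stationary for
    the transition probabilities [step]. *)
Lemma site_marginal v i : mu (at_ v i) = (w i * z i / walk_norm)%:E.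
Proof.
elim: {v}(size (word v)) {-2}v (erefl (size (word v))) i => [|n IH] v sv i.
  by move: sv => /eqP; rewrite size_eq0 word_nil => /eqP ->; exact: root_marginal.
have vr : v != root r by rewrite -size_gt0 sv.
rewrite (mu_coord_sum (parent v)) //; last exact: measurable_coord.
rewrite (eq_bigr (fun k => ((w i * ((adj i k)%:R * w k)) / walk_norm)%:E)) => [|k _]; last first.
  rewrite child_step // IH ?size_parent ?sv // -EFinM /step adj_sym.
  by congr EFin; field; rewrite walk_norm_neq0 lt0r_neq0.
by rewrite sumEFin -mulr_suml -mulr_sumr -zwE.
Qed.

Lemma marginal_neq0 v i : fine (mu (at_ v i)) != 0.
Proof. by rewrite site_marginal /= !mulf_neq0 ?invr_eq0 ?walk_norm_neq0 // lt0r_neq0. Qed.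

(** Reversibility: w_i z_i times [step i j] is w_i w_j on edges, which is symmetric, so the
    direction of the edge relative to the root is immaterial. *)
Lemma edge_marginal u v i j : tadj u v ->
  mu (at_ v j `&` at_ u i) = ((step i j)%:E * mu (at_ u i))%E.
Proof.
move=> /orP[]; rewrite childE => /andP[cr /eqP ->]; first exact: child_step.
rewrite setIC child_step // !site_marginal -!EFinM /step (adj_sym j).
by congr EFin; field; rewrite walk_norm_neq0 !lt0r_neq0.
Qed.

(** Independence across the edge, divided by the nonzero probability of the spin at [u]. The law
    thus grows by one [step] in any direction, even towards the root. *)
Lemma markov_step u v i j B : tadj u v -> coord_sigma (~` [set x | side u v x]) B ->
  mu (at_ v j `&` (B `&` at_ u i)) = ((step i j)%:E * mu (B `&` at_ u i))%E.
Proof.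
move=> uv sB; have mB := coord_sigma_measurable sB.
have sA : coord_sigma [set x | side u v x] (at_ v j).
  by apply: coord_sigma_coord; have [] := side_end uv.
have := side_indep mu_law i uv sA sB.
have mE := @measurable_coord r q; have mI := @measurableI _ (Omega r q).
rewrite /= edge_marginal // (muE (mE u i)) (muE (mI _ _ mB (mE u i))).
rewrite (muE (mI _ _ (mE v j) (mI _ _ mB (mE u i)))) -!EFinM => -[h].
congr EFin; apply: (mulfI (marginal_neq0 u i)); rewrite h; ring.
Qed.

Lemma walk_simple : is_simple mu.
Proof.
move=> u i E Epos vs A uvs auvs sA.
have e0 : fine (mu E) != 0 by exact: marginal_neq0.
have mE : measurable E by exact: measurable_coord.
have mI := @measurableI _ (Omega r q).
have sAm v : v \in vs -> measurable (A v) by move=> /sA/coord_sigma_measurable.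
elim: vs uvs auvs sA sAm => [|v vs IH] /=.
  by move=> _ _ _ _; rewrite big_nil bigcap_nil /condP setTI divff.
move=> /andP[vvs uvs] /andP[uv auvs] sA sAm.
rewrite big_cons -IH //; last 2 first.
- by move=> x xvs; apply: sA; rewrite inE xvs orbT.
- by move=> x xvs; apply: sAm; rewrite inE xvs orbT.
pose B := \bigcap_(x in [set x | x \in vs]) A x; rewrite -/B.
rewrite bigcap_cons -/B.
(* The remaining components all lie on the side of [u], so independence across [u v] splits off
   [A v]. *)
have sB : coord_sigma (~` [set x | side u v x]) B.
  apply: coord_sigma_bigcap => x xvs.
  have : coord_sigma (comp u x) (A x) by apply: sA; rewrite inE xvs orbT.
  apply: coord_sigma_subset => y yc /=; apply/negP.
  apply: (comp_other_side uv _ _ yc); first exact: (allP auvs).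
  by apply: contraNneq vvs => <-.
have sAv : coord_sigma [set x | side u v x] (A v).
  have : coord_sigma (comp u v) (A v) by apply: sA; rewrite mem_head.
  by apply: coord_sigma_subset => x; exact: comp_sub_side.
have := side_indep mu_law i uv sAv sB; rewrite /= -/E.
have mA := coord_sigma_measurable sAv; have mB := coord_sigma_measurable sB.
rewrite (muE mE) (muE (mI _ _ mB mE)) (muE (mI _ _ mA mE)) (muE (mI _ _ mA (mI _ _ mB mE))).
rewrite -!EFinM => -[h]; rewrite /condP -setIA.
by rewrite mulf_div (mulrC (fine (mu (A v `&` E)))) -h; field.
Qed.

(** Both probabilities are built by the same [step] factors along the list, starting from a one-site
    marginal that does not depend on the site. *)
Lemma automorphism_cylinder s L xi : automorphism s -> admissible L ->
  mu (cylinder (map s L) xi) = mu (cylinder L (xi \o s)).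
Proof.
move=> aut aL.
have cyl1 x (eta : site r -> 'I_q.+1) : cylinder [:: x] eta = at_ x (eta x).
  apply/seteqP; split => phi /=; first by apply; rewrite mem_head.
  by move=> h u; rewrite inE => /eqP ->.
elim: aL => [x|u v L' aL' IH vL uL uv]; first by rewrite /= !cyl1 !site_marginal.
have [bs hs] := aut.
have key K a b (eta : site r -> 'I_q.+1) : admissible K -> b \notin K -> a \in K -> tadj a b ->
    mu (cylinder (b :: K) eta) = ((step (eta a) (eta b))%:E * mu (cylinder K eta))%E.
  move=> aK bK aK' ab.
  have E : cylinder K eta `&` at_ a (eta a) = cylinder K eta.
    by apply: setIidl => phi; apply.
  rewrite cylinder_cons -{1}E markov_step ?E // ; apply: coord_sigma_cylinder => x xK /=.
  exact/negP/(admissible_side aK).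
rewrite /= (key _ (s u)) ?(key _ u) //= ?IH //.
- exact: admissible_map.
- by rewrite mem_map //; exact: bij_inj.
- exact: map_f.
- by rewrite hs.
Qed.

Lemma measurable_coord_sigmaT A : measurable A -> @coord_sigma r q setT A.
Proof.
apply: smallest_sub; first exact: smallest_sigma_algebra.
by move=> _ [v [i ->]]; exact: coord_sigma_coord.
Qed.

Lemma walk_invariant : is_invariant mu.
Proof.
move=> s aut A mA; have [bs hs] := aut; have [g sg gs] := bs.
pose T (phi : Omega r q) : Omega r q := phi \o s.
have mT : measurable_fun setT T.
  apply: (@measurability _ _ (Omega r q) (Omega r q) setT T (@cyl r q)) => //.
  by move=> _ [B [v [i ->]] <-]; rewrite setTI; exact: measurable_coord.
pose X : {mfun Omega r q >-> Omega r q} :=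
  @mfun_Sub _ _ (Omega r q) (Omega r q) T (mem_set mT).
rewrite -[LHS]/(distribution mu X A).
apply: (@coord_sigma_unique R r q (distribution mu X) mu setT 0); last exact: measurable_coord_sigmaT.
  by rewrite -ge0_fin_numE ?measure_ge0 // fin_num_measure.
move=> N xi _.
have LE : ballS setT N =i rev (take (size (bfs r N)) (bfs r N)).
  by move=> v; rewrite mem_ballS mem_rev take_size mem_bfs; case: asboolP => // -[].
have aL : admissible (rev (take (size (bfs r N)) (bfs r N))).
  apply: admissible_bfs => //.
  have : root r \in bfs r N by rewrite mem_bfs.
  by case: (bfs r N).
rewrite (@eq_cylinder _ _ _ _ xi xi LE) //.
set L := rev _ in aL *.
(* The pulled-back cylinder is the one over [map s L] with spins [xi \o g], where [g] inverts
   [s]. *)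
rewrite -[in RHS](_ : (xi \o g) \o s = xi); last by apply/funext => v /=; rewrite sg.
apply: (etrans _ (automorphism_cylinder (xi \o g) aut aL)); congr (mu _).
apply/seteqP; split => phi /= h.
  by move=> _ /mapP[v vL ->]; rewrite /= sg; exact: h.
by move=> v vL; rewrite /T /= h ?map_f //= sg.
Qed.

Lemma walk_homs : mu (@homs r q adj) = 1%E.
Proof.
(* Violations of the homomorphism condition form a countable union of null events, one for each
   non-root site and pair of non-adjacent spins, enumerated by [unpickle]. *)
pose F n : set (Omega r q) :=
  if @unpickle (site r * 'I_q.+1 * 'I_q.+1)%type n is Some (v, i, j) then
    if (v != root r) && ~~ adj i j then at_ v j `&` at_ (parent v) i else set0
  else set0.
have mF n : measurable (F n).
  rewrite /F; case: unpickle => [[[v i] j]|] //; case: ifP => // _.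
  by apply: measurableI; exact: measurable_coord.
have F0 n : mu (F n) = 0%E.
  rewrite /F; case: unpickle => [[[v i] j]|] //; case: ifP => // /andP[vr /negPf nij].
  by rewrite child_step // /step nij mul0r mul0e.
have mU : measurable (\bigcup_n F n) by exact: bigcup_measurable.
have U0 : mu (\bigcup_n F n) = 0%E.
  apply: measure_negligible => //; apply: negligible_bigcup => n.
  by exists (F n); split; [exact: mF|exact: F0|].
have -> : @homs r q adj = ~` (\bigcup_n F n).
  apply/seteqP; split => phi /=.
    move=> h [n _]; rewrite /F; case: unpickle => [[[v i] j]|] //; case: ifP => // /andP[vr nij].
    move=> [/= hv hp]; move: nij; rewrite -hv -hp h //.
    by rewrite /tadj child_parent.
  move=> h; have key v : v != root r -> adj (phi (parent v)) (phi v).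
    move=> vr; apply/negPn/negP => nad; apply: h.
    exists (pickle (v, phi (parent v), phi v)) => //.
    by rewrite /F pickleK vr nad.
  move=> u v /orP[]; rewrite childE => /andP[vr /eqP ->]; first exact: key.
  by rewrite adj_sym; exact: key.
by rewrite probability_setC // U0 sube0.
Qed.

End WalkMarginals.

(** * The Gibbs property *)

Section Density.
Variables (R : realType) (r q : nat) (adj : rel 'I_q.+1) (w : 'I_q.+1 -> R).
Hypotheses (w_gt0 : forall i, 0 < w i) (z_gt0 : forall i, 0 < zw adj w i).
Local Notation z := (zw adj w).
Local Notation spin_factor := (@spin_factor R r q adj w).
Local Notation walk_norm := (@walk_norm R q adj w).

Lemma reduced_rcons (u : site r) a :
  reduced (rcons (word u) a) = (u == root r) || (last a (word u) != a).
Proof.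
rewrite -word_nil; case: u => -[|b s] //= rs.
by rewrite /reduced /= rcons_path; move: rs; rewrite /reduced /= => ->.
Qed.

(** A child appends a letter different from the last one: r choices, or r + 1 at the root, whose
    word is empty. *)
Lemma count_children (u : site r) n : size (word u) = n ->
  count (fun v => u == parent v) (level r n.+1) = (r + (u == root r))%N.
Proof.
move=> su; rewrite -size_filter.
have -> : size [seq v <- level r n.+1 | u == parent v] =
    size (pmap insub [seq rcons (word u) a | a <- enum 'I_r.+1] : seq (site r)).
  apply/perm_size/uniq_perm.
  - by rewrite !filter_uniq // uniq_ball.
  - by rewrite pmap_sub_uniq // map_inj_uniq ?enum_uniq // => a b /rcons_inj[].
  move=> v; rewrite mem_filter mem_level mem_pmap_sub; apply/andP/mapP.
    move=> [/eqP uv /eqP sv].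
    have pv := word_parent v; rewrite -uv in pv.
    have [s [a va]] : exists s a, word v = rcons s a.
      by move: sv; case/lastP: (word v) => // s a _; exists s, a.
    move: pv; rewrite /droplast va size_rcons /= -cats1 take_size_cat // => ->.
    by exists a; rewrite ?mem_enum // va.
  move=> [a _ va]; rewrite va size_rcons su eqxx; split=> //.
  rewrite -val_eqE /= word_parent va /droplast size_rcons -cats1 /=.
  by rewrite take_size_cat.
rewrite size_pmap_sub count_map.
under eq_count => a do rewrite /= reduced_rcons.
have [_|ur] := eqVneq u (root r).
  by rewrite addn1 -[RHS](size_enum_ord r.+1) -[RHS]count_predT.
have [b bE] : exists b, forall a, last a (word u) = b.
  by move: ur; rewrite -word_nil; case: (word u) => // b s _; exists (last b s).
under eq_count => a do rewrite /= bE.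
have -> : count (fun a => b != a) (enum 'I_r.+1) = #|predC1 b|.
  by rewrite cardE enumT size_filter; apply: eq_count => a; rewrite !inE eq_sym.
by rewrite cardC1 card_ord addn0.
Qed.

Lemma prod_children (F : site r -> R) n :
  \prod_(v <- level r n.+1) F (parent v) =
  \prod_(u <- level r n) F u ^+ (r + (u == root r)).
Proof.
have uniq_lev k : uniq (level r k) by rewrite filter_uniq // uniq_ball.
transitivity (\prod_(v <- level r n.+1) \prod_(u <- level r n | u == parent v) F u).
  rewrite big_seq [RHS]big_seq; apply: eq_bigr => v; rewrite mem_level => /eqP sv.
  rewrite -big_filter (_ : [seq _ <- _ | _] = [:: parent v]) ?big_seq1 //.
  rewrite (@eq_filter _ _ (pred1 (parent v))) // filter_pred1_uniq //.
  by rewrite mem_level size_parent sv.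
rewrite (exchange_big_dep predT) //=.
rewrite big_seq [RHS]big_seq; apply: eq_bigr => u; rewrite mem_level => /eqP su.
by rewrite -(count_children su) big_const_seq -Monoid.iteropE.
Qed.

(** An interior site contributes [w] by itself and 1/z through each of its r children. The root has
    r + 1 children, but its own factor carries an extra [z], so it too contributes w / z^r. *)
Lemma ball_density n (psi : site r -> 'I_q.+1) :
  \prod_(v <- bfs r n.+1) spin_factor v psi =
  walk_norm^-1 * \prod_(v <- bfs r n) (w (psi v) / z (psi v) ^+ r) *
  \prod_(v <- level r n.+1) w (psi v) *
  \prod_(v <- bfs r n.+1 | v != root r) (adj (psi (parent v)) (psi v))%:R.
Proof.
have levN k v : v \in level r k.+1 -> v != root r.
  by rewrite mem_level => /eqP sv; rewrite -size_gt0 sv.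
have facL k : \prod_(v <- level r k.+1) spin_factor v psi =
    \prod_(v <- level r k.+1) w (psi v) *
    \prod_(v <- level r k.+1) (z (psi (parent v)))^-1 *
    \prod_(v <- level r k.+1 | v != root r) (adj (psi (parent v)) (psi v))%:R.
  rewrite -big_split /= [X in _ * X]big_seq_cond.
  rewrite [X in _ * X](eq_bigl (fun v => v \in level r k.+1)); last first.
    by move=> v; case: (boolP (v \in _)) => // /levN ->.
  rewrite -big_seq -big_split /= big_seq [RHS]big_seq; apply: eq_bigr => v vL.
  by rewrite /spin_factor (negPf (levN _ _ vL)); ring.
elim: n => [|n IH].
  rewrite [bfs r 1]/= !big_cat /= facL (prod_children (fun u => (z (psi u))^-1)).
  rewrite level0 !big_seq1 eqxx big_cons big_nil eqxx /= mul1r /spin_factor eqxx.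
  rewrite exprVn addn1 exprS invfM; have := z_gt0 (psi (root r)).
  by move=> /lt0r_neq0 z0; field; rewrite z0 expf_neq0 // gt_eqF // walk_norm_gt0.
have bE k : bfs r k.+1 = bfs r k ++ level r k.+1 by [].
rewrite (bE n.+1) [in LHS]big_cat IH facL.
rewrite [X in _ = _ * X]big_cat (prod_children (fun u => (z (psi u))^-1)).
have -> : \prod_(v <- bfs r n.+1) (w (psi v) / z (psi v) ^+ r) =
    \prod_(v <- bfs r n) (w (psi v) / z (psi v) ^+ r) *
    (\prod_(v <- level r n.+1) w (psi v) *
     \prod_(u <- level r n.+1) (z (psi u))^-1 ^+ (r + (u == root r))).
  rewrite bE big_cat /=; congr (_ * _).
  rewrite -big_split /= big_seq [RHS]big_seq; apply: eq_bigr => v vL.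
  by rewrite (negPf (levN _ _ vL)) addn0 exprVn.
rewrite /=; ring.
Qed.

End Density.

(** * Comparison of the density of a ball with the weights of a patch *)

Section Gibbs.
Variables (R : realType) (r q : nat) (adj : rel 'I_q.+1) (w lam : 'I_q.+1 -> R) (kappa : R).
Hypothesis adj_sym : symmetric adj.
Hypotheses (w_gt0 : forall i, 0 < w i) (z_gt0 : forall i, 0 < zw adj w i).
Hypotheses (lam_gt0 : forall i, 0 < lam i) (kappa_gt0 : 0 < kappa).
Hypothesis lamE : forall i, lam i * zw adj w i ^+ r = kappa * w i.
Local Notation z := (zw adj w).
Local Notation spin_factor := (@spin_factor R r q adj w).
Local Notation walk_norm := (@walk_norm R q adj w).
Implicit Types (U : seq (site r)) (psi phi eta : site r -> 'I_q.+1).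

Lemma inplus_parent U v : v \in U \/ parent v \in U -> v != root r ->
  inplus U v /\ inplus U (parent v).
Proof.
move=> h /child_parent pv; split; apply/orP.
  by case: h => h; [left|right; apply/hasP; exists (parent v); rewrite // /tadj pv].
by case: h => h; [right; apply/hasP; exists v; rewrite // /tadj pv orbT|left].
Qed.

Lemma prod_bool (I : eqType) (s : seq I) (P Q : pred I) :
  \prod_(i <- s | P i) (Q i)%:R = (all (fun i => P i ==> Q i) s)%:R :> R.
Proof.
elim: s => [|i s IH]; first by rewrite big_nil.
rewrite big_cons /= IH; case: (P i) => //=.
by case: (Q i); rewrite ?mul1r ?mul0r.
Qed.

(** At sites of [U] the factor w / z^r is lam / kappa; what remains besides the adjacency indicator
    depends on [eta] alone and goes into [C]. The extra level keeps [U] in the interior of the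
    ball. *)
Lemma density_gibbs U n (eta : site r -> 'I_q.+1) : uniq U -> {subset U <= bfs r n} ->
  exists C : R, forall zeta : site r -> 'I_q.+1,
    \prod_(v <- bfs r n.+1) spin_factor v (mix U zeta eta) =
    C * weightU adj lam U (mix U zeta eta).
Proof.
move=> uU Un.
(* Edges to the parent with both ends in U^+: they make up the indicator in [weightU], and all other
   edges miss [U]. *)
pose inn v := inplus U v && inplus U (parent v).
exists (walk_norm^-1 * (kappa^-1 ^+ size U *
  \prod_(v <- bfs r n | v \notin U) (w (eta v) / z (eta v) ^+ r)) *
  \prod_(v <- level r n.+1) w (eta v) *
  \prod_(v <- bfs r n.+1 | (v != root r) && ~~ inn v) (adj (eta (parent v)) (eta v))%:R) => zeta.
set psi := mix U zeta eta.
have psiN v : v \notin U -> psi v = eta v by rewrite /psi /mix => /negPf ->.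
rewrite ball_density //.
have -> : \prod_(v <- bfs r n) (w (psi v) / z (psi v) ^+ r) =
   (kappa^-1 ^+ size U * \prod_(u <- U) lam (psi u)) *
   \prod_(v <- bfs r n | v \notin U) (w (eta v) / z (eta v) ^+ r).
  rewrite (bigID (fun v => v \in U)) /=; congr (_ * _); last first.
    by apply: eq_bigr => v vU; rewrite psiN.
  rewrite -big_filter (perm_big U) /=; last first.
    apply: uniq_perm; rewrite ?filter_uniq ?uniq_bfs // => v.
    by rewrite mem_filter; case: (boolP (v \in U)) => // /Un ->.
  elim: (U) => [|u s IH]; first by rewrite !big_nil mulr1.
  rewrite !big_cons IH /= exprS.
  have -> : w (psi u) / z (psi u) ^+ r = kappa^-1 * lam (psi u).
    apply: (mulfI (lt0r_neq0 kappa_gt0)); rewrite mulrA -lamE mulfK; last by rewrite expf_neq0 // gt_eqF.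
    by rewrite mulVKf // gt_eqF.
  by move: (kappa^-1) => k; ring.
have -> : \prod_(v <- level r n.+1) w (psi v) = \prod_(v <- level r n.+1) w (eta v).
  rewrite big_seq [RHS]big_seq; apply: eq_bigr => v vL; rewrite psiN //.
  by apply/negP => /Un; move: vL; rewrite mem_level mem_bfs => /eqP ->; rewrite ltnn.
rewrite [X in _ * X = _](bigID inn) /=.
have -> : \prod_(v <- bfs r n.+1 | (v != root r) && ~~ inn v) (adj (psi (parent v)) (psi v))%:R =
  \prod_(v <- bfs r n.+1 | (v != root r) && ~~ inn v) (adj (eta (parent v)) (eta v))%:R :> R.
  apply: eq_bigr => v /andP[vr nv].
  have vU : v \notin U.
    by apply: contra nv => vU; have [h1 h2] := inplus_parent (or_introl vU) vr; rewrite /inn h1 h2.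
  have pU : parent v \notin U.
    by apply: contra nv => pU; have [h1 h2] := inplus_parent (or_intror pU) vr; rewrite /inn h1 h2.
  by rewrite !psiN.
have -> : \prod_(v <- bfs r n.+1 | (v != root r) && inn v) (adj (psi (parent v)) (psi v))%:R =
  (`[< forall u v, inplus U u -> inplus U v -> tadj u v -> adj (psi u) (psi v) >])%:R :> R.
  rewrite prod_bool; congr (nat_of_bool _)%:R; apply/allP/asboolP => [h u v pu pv|h v vN].
    have inN x : inplus U x -> x \in bfs r n.+1.
      case/orP => [/Un|/hasP[y /Un]]; rewrite !mem_bfs; first exact: leqW.
      move=> yn /orP[]; rewrite childE => /andP[xr /eqP E].
        by move: yn; rewrite E size_parent; case: (size (word x)).
      by rewrite E size_parent (leq_trans (leq_pred _)) // leqW.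
    case/orP; rewrite childE => /andP[xr /eqP E]; rewrite E in pu pv *.
      by have /implyP := h _ (inN _ pv); apply; rewrite xr /inn pv pu.
    by rewrite adj_sym; have /implyP := h _ (inN _ pu); apply; rewrite xr /inn pv pu.
  apply/implyP => /andP[vr /andP[pv pp]]; apply: h => //.
  by rewrite /tadj child_parent.
by rewrite /weightU; ring.
Qed.

Lemma weightU_ext U psi psi' : (forall v, inplus U v -> psi v = psi' v) ->
  weightU adj lam U psi = weightU adj lam U psi'.
Proof.
move=> h; rewrite /weightU; congr (_ * _%:R).
  by rewrite big_seq [RHS]big_seq; apply: eq_bigr => u uU; rewrite h // /inplus uU.
congr nat_of_bool; apply/asboolP/asboolP => hh u v pu pv uv.
  by rewrite -!h //; exact: hh.
by rewrite !h //; exact: hh.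
Qed.

Lemma weightU_ge0 U psi : 0 <= weightU adj lam U psi.
Proof. by rewrite mulr_ge0 // prodr_ge0 // => i _; exact: ltW. Qed.

Lemma mix_ext U zeta phi phi' v : v \in U \/ phi v = phi' v ->
  mix U zeta phi v = mix U zeta phi' v.
Proof. by rewrite /mix; case: ifP => // _ []. Qed.

Lemma gamma_ext U xi phi phi' :
  (forall v, inplus U v -> v \notin U -> phi v = phi' v) ->
  gamma adj lam U xi phi = gamma adj lam U xi phi'.
Proof.
move=> h.
have e zeta : weightU adj lam U (mix U zeta phi) = weightU adj lam U (mix U zeta phi').
  apply: weightU_ext => v pv; apply: mix_ext.
  by case: (boolP (v \in U)) => vU; [left|right; exact: h].
by rewrite /gamma e; congr (_ / _); apply: eq_bigr => t _; exact: e.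
Qed.

Lemma gamma_ge0 U xi phi : 0 <= gamma adj lam U xi phi.
Proof. by rewrite divr_ge0 ?weightU_ge0 ?sumr_ge0 // => t _; exact: weightU_ge0. Qed.

End Gibbs.

(** * Conditional probabilities of the walk *)

Section WalkGibbs.
Variables (R : realType) (r q : nat) (adj : rel 'I_q.+1) (w lam : 'I_q.+1 -> R) (kappa : R).
Hypothesis adj_sym : symmetric adj.
Hypotheses (w_gt0 : forall i, 0 < w i) (z_gt0 : forall i, 0 < zw adj w i).
Hypotheses (lam_gt0 : forall i, 0 < lam i) (kappa_gt0 : 0 < kappa).
Hypothesis lamE : forall i, lam i * zw adj w i ^+ r = kappa * w i.
Variable mu : probability (Omega r q) R.
Hypothesis mu_law : forall N n xi, (n <= size (bfs r N))%N ->
  mu (cylinder (take n (bfs r N)) xi) = (\prod_(v <- take n (bfs r N)) spin_factor adj w v xi)%:E.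

Local Notation outside U := (~` [set u : site r | u \in U]).

Let mu_config L (A : set (Omega r q)) : uniq L -> measurable A ->
  mu A = (\sum_(t : (size L).-tuple 'I_q.+1) mu (A `&` cylinder L (@config r q L t)))%E.
Proof. exact: measure_config. Qed.

(** The constant of [density_gibbs] does not depend on the spins in [U], so it cancels against the
    sum over all patterns on [U]. *)
Lemma gibbs_cylinder (U : seq (site r)) n N (xi eta : site r -> 'I_q.+1) :
  uniq U -> {subset U <= bfs r n} -> (n < N)%N ->
  mu (cylinder (ballS (outside U) N) eta `&` cylinder U xi) =
  ((gamma adj lam U xi eta)%:E * mu (cylinder (ballS (outside U) N) eta))%E.
Proof.
case: N => // N uU Un; rewrite ltnS => nN.
have UN : {subset U <= bfs r N}.
  by move=> u /Un; rewrite !mem_bfs => /leq_trans; exact.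
have [C hC] := density_gibbs adj_sym w_gt0 z_gt0 kappa_gt0 lamE eta uU UN.
set A := cylinder _ eta.
have mA : measurable A by exact: measurable_cylinder.
have cE zeta : mu (A `&` cylinder U zeta) = (C * weightU adj lam U (mix U zeta eta))%:E.
  rewrite -hC -(perm_big _ (perm_bfs r N.+1)) /= -(mu_ball mu_law); congr (mu _).
  apply/seteqP; split => phi /=.
    move=> [hA hU] v vN; rewrite /mix; case: ifP => [/hU //|vU].
    by apply: hA; rewrite mem_ballS -mem_ball vN andbT; apply/asboolP => /=; rewrite vU.
  move=> h; split => v vU.
    move: vU; rewrite mem_ballS -mem_ball => /andP[/asboolP /= /negP/negPf vU vN].
    by rewrite h // /mix vU.
  by rewrite h ?/mix ?vU // (perm_mem (perm_bfs r N.+1)) mem_bfs leqW // -mem_bfs UN.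
rewrite cE (mu_config uU mA).
under eq_bigr => t _ do rewrite cE.
rewrite sumEFin -EFinM -mulr_sumr /gamma.
set s := \sum_t _.
(* If the normalising sum vanishes, so do its nonnegative terms, among them the weight of [xi]; both
   sides are then 0. *)
congr EFin; have [s0|s0] := eqVneq s 0; last by field.
have [t ht] := config_ex xi uU.
have -> : weightU adj lam U (mix U xi eta) = weightU adj lam U (mix U (config t) eta).
  by apply: weightU_ext => v _; rewrite /mix; case: ifP => // vU; rewrite ht.
rewrite s0 !mulr0.
move: s0 => /eqP; rewrite psumr_eq0 => [/allP/(_ t)|i _]; last exact: weightU_ge0.
by rewrite mem_index_enum => /(_ isT)/eqP ->; rewrite mulr0.
Qed.

Lemma walk_gibbs : is_gibbs adj lam mu.
Proof.
split; first exact (@walk_homs R r q adj w adj_sym mu mu_law).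
move=> U uU xi A sA; set X := [set phi : Omega r q | _].
pose n := \max_(u <- U) size (word u).
have Un : {subset U <= bfs r n}.
  by move=> u uU'; rewrite mem_bfs; exact: (@leq_bigmax_seq _ U predT (fun u => size (word u))).
(* Radius [n.+1] takes in the boundary of [U], so [gamma] is constant on each cylinder over [L] and
   its integral becomes a finite sum. *)
pose L := ballS (outside U) n.+1.
have uL : uniq L by exact: uniq_ballS.
pose c t := cylinder L (@config r q L t).
pose g t := gamma adj lam U xi (@config r q L t).
have inL v : inplus U v -> v \notin U -> v \in L.
  case/orP => [-> //|/hasP[u /Un]]; rewrite mem_bfs => un uv vU.
  rewrite mem_ballS; apply/andP; split; first by apply/asboolP => /=; exact/negP.
  move: uv => /orP[]; rewrite childE => /andP[xr /eqP E].
    by move: un; rewrite E size_parent; case: (size (word v)).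
  by rewrite E size_parent (leq_trans (leq_pred _)) // leqW.
have mA := coord_sigma_measurable sA.
have mX : measurable X by exact: (measurable_cylinder U xi).
have mc t : measurable (c t) by exact: measurable_cylinder.
have g0 t : 0 <= g t by exact: gamma_ge0.
have gammaE (phi : Omega r q) : (gamma adj lam U xi phi)%:E = (\sum_t (g t)%:E * (\1_(c t) phi)%:E)%E.
  have [t ht] := config_ex phi uL.
  rewrite (bigD1 t) //= big1 => [|t' tt']; last first.
    rewrite indicE memNset ?mule0 // => h; move: tt'; apply/negP/negPn/eqP.
    exact: cylinder_disjoint uL h ht.
  rewrite indicE mem_set // mule1 adde0; congr EFin; apply: gamma_ext => v pv vU.
  by apply: ht; exact: inL.
under [RHS]eq_integral => phi _ do rewrite gammaE.
rewrite ge0_integral_sum //; last 2 first.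
- move=> t; apply: measurable_funeM; apply/measurable_EFinP.
  exact: measurable_indic.
- by move=> t phi _; rewrite mule_ge0 ?lee_fin.
rewrite (mu_config uL) //; last exact: measurableI.
apply: eq_bigr => t _.
have -> : (\int[mu]_(phi in A) ((g t)%:E * (\1_(c t) phi)%:E) =
    (g t)%:E * \int[mu]_(phi in A) (\1_(c t) phi)%:E)%E.
  apply: ge0_integralZl_EFin => //.
  by apply/measurable_EFinP; exact: measurable_indic.
rewrite integral_indic // -/(c t) (setIC X) -setIA (setIC (c t)) -[LHS]mul1e.
have mXc : measurable (X `&` c t) by exact: measurableI.
(* For fixed [t] it is enough to treat cylinders over large balls outside [U]; each of them lies in
   [c t] or is disjoint from it. *)
apply: (coord_sigma_scaled (N0 := n.+1) mXc (mc t) ler01 (g0 t) _ sA) => N eta nN.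
set K := cylinder _ eta; rewrite mul1e.
have LK : {subset L <= ballS (outside U) N}.
  by move=> v; rewrite !mem_ballS => /andP[-> /leq_trans]; exact.
have [h|nh] := pselect {in L, eta =1 @config r q L t}.
  have Kc : K `&` c t = K.
    by apply: setIidl => phi hphi v vL; rewrite hphi ?LK // h.
  rewrite (setIC X) setIA Kc (gibbs_cylinder (n := n)) //; congr (_%:E * _)%E.
  by apply: gamma_ext => v pv vU; apply: h; exact: inL.
have Kc : K `&` c t = set0.
  apply/seteqP; split => phi //= -[h1 h2]; apply: nh => v vL.
  by rewrite -h1 ?LK // h2.
by rewrite (setIC X) setIA Kc set0I measure0 mule0.
Qed.

End WalkGibbs.

Theorem theorem5p2 (R : realType) (r : nat) (hr : (2 <= r)%N)
  (q : nat) (adj : rel 'I_q.+1)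
  (adj_sym : symmetric adj)
  (H_connected : forall i j : 'I_q.+1, connect adj i j)
  (H_edge : exists i j : 'I_q.+1, adj i j)
  (lam : 'I_q.+1 -> R) (lam_pos : forall i, 0 < lam i) :
  exists w : 'I_q.+1 -> R,
    (forall i, 0 < w i) /\
    exists mu : probability (Omega r q) R,
      is_rw_law adj w mu /\ is_gibbs adj lam mu /\ is_simple mu /\ is_invariant mu.
Proof.
have [w [kappa [w0 z0 k0 lamE]]] := walk_weights adj_sym lam_pos (ltnW hr) H_connected H_edge.
have [mu mu_law] := walk_measure r w0 z0.
exists w; split=> //; exists mu; split; last split; last split.
- move=> N xi; rewrite -[LHS]/(mu (cylinder (ball r N) xi)) (mu_ball mu_law) /rw_cyl.
  congr EFin; rewrite (bigD1_seq (root r)) ?uniq_ball ?mem_ball //= {1}/spin_factor eqxx.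
  by congr (_ * _); apply: eq_bigr => v vr; rewrite /spin_factor (negPf vr).
- exact (walk_gibbs adj_sym w0 z0 lam_pos k0 lamE mu_law).
- exact (walk_simple adj_sym w0 z0 mu_law).
- exact (walk_invariant adj_sym w0 z0 mu_law).
Qed.
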